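(* Let $I$ be a nonzero proper squarefree monomial ideal of $S=\mathbb{K}[x_1,\ldots,x_n]$. (i) For every pair of positive integers $k,m$, we have $$\operatorname{reg}(I^{(km)})\geq \operatorname{reg}(I^{(m)})+(k-1)m.$$ (ii) $\operatorname{reg}(I^{(3)})\geq \operatorname{reg}(I^{(2)})+1$.
   Context: $\mathbb{K}$ is a field and $S=\mathbb{K}[x_1,\ldots,x_n]$ is the (standard graded) polynomial ring in $n$ variables. For a graded $S$-module $M$ with graded Betti numbers $\beta_{i,j}(M)$ (so the minimal graded free resolution of $M$ has $i$-th term $\bigoplus_j S(-j)^{\beta_{i,j}(M)}$), the Castelnuovo--Mumford regularity is $\operatorname{reg}(M)=\max\{j-i : \beta_{i,j}(M)\neq 0\}$; ideals are regarded as graded $S$-modules. For an integer $m\geq 1$, the $m$-th symbolic power of a monomial ideal $I$ is $$I^{(m)}=\bigcap_{\mathfrak{p}\in \operatorname{Min}(I)} \operatorname{Ker}\big(S\rightarrow (S/I^m)_{\mathfrak{p}}\big),$$ where $\operatorname{Min}(I)$ is the set of minimal prime ideals of $I$. *)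

(* Defs.v *)
From mathcomp Require Import all_boot all_order all_algebra.
From mathcomp Require Import boolp classical_sets.
From mathcomp Require Import mpoly.

Set Implicit Arguments.
Unset Strict Implicit.
Unset Printing Implicit Defensive.

Import GRing.Theory Num.Theory.

Local Open Scope classical_set_scope.
Local Open Scope ring_scope.

(* Unlike [idealr_closed] of ring_quotient, this allows the unit ideal. *)
Definition is_ideal (R : comNzRingType) (I : set R) : Prop :=
  [/\ I 0, forall f g, I f -> I g -> I (f + g) & forall f g, I g -> I (f * g)].

Definition ideal_gen (R : comNzRingType) (A : set R) : set R :=
  smallest (@is_ideal R) A.

Definition ideal_pow (R : comNzRingType) (I : set R) (m : nat) : set R :=
  ideal_gen [set f | exists2 u : 'I_m -> R, forall i, I (u i) &
                     f = \prod_(i < m) u i].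

(* [idealr_closed] includes properness. *)
Definition is_prime_ideal (R : comNzRingType) (p : set R) : Prop :=
  idealr_closed [pred f in p] /\ prime_idealr_closed [pred f in p].

Definition min_primes (R : comNzRingType) (I : set R) : set (set R) :=
  [set p | [/\ is_prime_ideal p, I `<=` p &
             forall q, is_prime_ideal q -> I `<=` q -> q `<=` p -> q = p]].

(* The kernel of R -> (R / J)_p: the fraction f/1 vanishes there iff some
   s outside p kills the class of f in R / J. *)
Definition loc_kernel (R : comNzRingType) (J p : set R) : set R :=
  [set f | exists2 s, ~ p s & J (s * f)].

Definition symbolic_power (R : comNzRingType) (I : set R) (m : nat) : set R :=
  \bigcap_(p in min_primes I) loc_kernel (ideal_pow I m) p.

Definition squarefree_mnm (n : nat) (a : 'X_{1..n}) : Prop :=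
  forall i, (a i <= 1)%N.

Definition squarefree_monomial_ideal (K : fieldType) (n : nat)
    (I : set {mpoly K[n]}) : Prop :=
  exists2 A : set 'X_{1..n}, (forall a, A a -> squarefree_mnm a) &
    I = ideal_gen [set f | exists2 a, A a & f = 'X_[a]].

(* Homogeneity for an integer degree: S_d = 0 for d < 0. *)
Definition zhomog (K : fieldType) (n : nat) (d : int) (f : {mpoly K[n]}) : Prop :=
  match d with
  | Posz e => f \is e.-homog
  | Negz _ => f = 0
  end.

(* Data of a sequence ... -> F_1 -> F_0 -> S of finite free modules over
   S = K[x_1,...,x_n], where F_i is the sum over a < gf_rank i of
   S(- gf_shift a). Elements of F_i are row vectors, and maps act by right
   multiplication, so row a of a matrix is the image of the a-th generator. *)
Record gfree_seq (K : fieldType) (n : nat) := GFreeSeq {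
  gf_rank : nat -> nat;
  gf_shift : forall i, 'I_(gf_rank i) -> int;
  gf_aug : 'cV[{mpoly K[n]}]_(gf_rank 0);
  gf_diff : forall i, 'M[{mpoly K[n]}]_(gf_rank i.+1, gf_rank i)
}.

(* F is a minimal graded free resolution of the ideal I, as an S-module. The
   last clause says that im(F_(i+1) -> F_i) lies in (x_1,...,x_n) F_i. *)
Definition is_min_resolution (K : fieldType) (n : nat)
    (F : gfree_seq K n) (I : set {mpoly K[n]}) : Prop :=
  [/\ (forall a, zhomog (gf_shift a) (gf_aug F a 0)) /\
      (forall i a b, zhomog (gf_shift a - gf_shift b) (gf_diff F i a b)),
      I = [set (v *m gf_aug F) 0 0 | v in [set: 'rV_(gf_rank F 0)]],
      forall v : 'rV_(gf_rank F 0),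
        v *m gf_aug F = 0 <-> exists w, v = w *m gf_diff F 0,
      forall i (v : 'rV_(gf_rank F i.+1)),
        v *m gf_diff F i = 0 <-> exists w, v = w *m gf_diff F i.+1 &
      forall i a b, (gf_diff F i a b)@_0%MM = 0].

(* beta_{i,j}(I), the number of copies of S(-j) in the i-th term of a minimal
   graded free resolution of I (the same for all of them). *)
Definition betti (K : fieldType) (n : nat) (I : set {mpoly K[n]})
    (i : nat) (j : int) : nat :=
  xget 0%N [set b | exists2 F : gfree_seq K n, is_min_resolution F I &
                    b = #|[set a : 'I_(gf_rank F i) | gf_shift a == j]%SET|].

Definition is_max (A : set int) : set int := A `&` ubound A.

Definition reg (K : fieldType) (n : nat) (I : set {mpoly K[n]}) : int :=
  xget 0 (is_max [set r | exists i j, betti I i j <> 0%N /\ r = j - i%:Z]).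

(* Main.v *)
(* For a monomial ideal J, the multidegrees a of the i-th step of a minimal free
   resolution are those where the Koszul homology H_i(J)_a does not vanish, so
   reg J is the largest |a| - i among them. In degree a, Koszul homology is the
   homology of the "box" with corners a - 1 and a, one unit interval per
   variable. Exactness of the homology sequence of a triple x <= y <= z in one
   variable allows to stretch every interval to [a_i - 1, N] without decreasing
   |a| - i, and conversely to cut [a_i - 1, N] down to unit intervals. For the
   symbolic power I^(m) of a squarefree ideal, a stretched box with lower corner
   b sees only which minimal primes P have b(P) >= m, where b(P) is the sum of
   the b_i with x_i in P. Replacing b by kb + (k-1)e_j (for I^(km)) or by 2b (for
   I^(3), starting from I^(2)), after raising |b| to at least m - 1, preserves
   these conditions and increases |b| by the required amount. *)
From HB Require Import structures.
Require Import Defs.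
From mathcomp Require Import all_boot all_order all_algebra.
From mathcomp Require Import boolp classical_sets.
From mathcomp Require Import mpoly.
From mathcomp Require Import fintype finset zify ring.

Set Implicit Arguments.
Unset Strict Implicit.
Unset Printing Implicit Defensive.

Import Order.TTheory GRing.Theory Num.Theory.

Local Open Scope ring_scope.

(** * Chains of the full simplex *)

(** [betti] counts in some chosen minimal resolution, so nothing is known about [reg] until a
    minimal resolution has been constructed and any two have been compared. Working in one
    multidegree at a time turns the construction into linear algebra over K: a submodule is a family
    of row spaces, its minimal generators span complements of row spaces, and passing to syzygies
    lowers the degree of Koszul homology by one. Polynomial matrices enter only when the steps are
    assembled. Boxes are stretched because in a unit box both ends of an interval can be close to
    the threshold m, and rescaling one end does not respect the other. Once all upper ends are at N
    > m, a prime containing a variable at its upper end satisfies its condition anyway, so only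
    lower ends matter. The summand k - 1 then comes from integrality: b(P) <= m - 1 gives k b(P) + k
    - 1 <= k m - 1. *)

Section SimplexChains.

Variables (K : fieldType) (n : nat) (V : lmodType K).
Implicit Types (c z w : {ffun {set 'I_n} -> V}) (t : {set 'I_n}) (j k l : 'I_n).

Definition ksign k t : K := (-1) ^+ #|[set l in t | (l < k)%N]|.

(** A chain is stored by its coefficients, so this is the augmented simplicial boundary read off at
    each face [t], the empty face included. *)
Definition kbd c : {ffun {set 'I_n} -> V} :=
  [ffun t : {set 'I_n} => \sum_(k | k \notin t) ksign k t *: c (k |: t)].

Definition kcone j c : {ffun {set 'I_n} -> V} :=
  [ffun t : {set 'I_n} => if j \in t then ksign j (t :\ j) *: c (t :\ j) else 0].

Lemma ksignU k l t : l \notin t ->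
  ksign k (l |: t) = (-1) ^+ (l < k)%N * ksign k t.
Proof.
move=> lt; rewrite /ksign -exprD; congr (_ ^+ _).
case: (boolP (l < k)%N) => lk.
  have -> : [set x in l |: t | (x < k)%N] = l |: [set x in t | (x < k)%N].
    by apply/setP=> x; rewrite !inE; case: eqP => // ->; rewrite lk.
  by rewrite cardsU1 !inE (negbTE lt).
rewrite add0n; congr #|pred_of_set _|; apply/setP=> x; rewrite !inE.
by case: eqP => // ->; rewrite (negbTE lk) !andbF.
Qed.

Lemma ksign_sqr k t : ksign k t * ksign k t = 1.
Proof. by rewrite /ksign -exprD addnn -mul2n exprM sqrrN !expr1n. Qed.

Lemma ksign_anti k l t : k != l -> k \notin t -> l \notin t ->
  ksign k t * ksign l (k |: t) = - (ksign l t * ksign k (l |: t)).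
Proof.
move=> kl kt lt; rewrite !ksignU //.
have [_|_|/val_inj/eqP] := ltngtP k l; last by rewrite (negbTE kl).
  by rewrite expr1 expr0; ring.
by rewrite expr1 expr0; ring.
Qed.

Lemma ksign_swap k l t : k != l -> k \notin t -> l \notin t ->
  ksign k (l |: t) * ksign l (k |: t) = - (ksign l t * ksign k t).
Proof.
move=> kl kt lt; rewrite !ksignU //.
have [_|_|/val_inj/eqP] := ltngtP k l; last by rewrite (negbTE kl).
  by rewrite expr1 expr0; ring.
by rewrite expr1 expr0; ring.
Qed.

Lemma kbdD c1 c2 : kbd (c1 + c2) = kbd c1 + kbd c2.
Proof.
apply/ffunP=> t; rewrite !ffunE -big_split; apply: eq_bigr => k _.
by rewrite ffunE scalerDr.
Qed.

Lemma kbdN c : kbd (- c) = - kbd c.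
Proof.
apply/ffunP=> t; rewrite !ffunE -sumrN; apply: eq_bigr => k _.
by rewrite ffunE scalerN.
Qed.

Lemma kbdB c1 c2 : kbd (c1 - c2) = kbd c1 - kbd c2.
Proof. by rewrite kbdD kbdN. Qed.

Lemma kbd_kbd c : kbd (kbd c) = 0.
Proof.
apply/ffunP=> t; rewrite ffunE [RHS]ffunE.
pose F k l := (ksign k t * ksign l (k |: t)) *: c (l |: (k |: t)).
have Fa k l : k != l -> k \notin t -> l \notin t -> F k l = - F l k.
  by move=> kl kt lt; rewrite /F ksign_anti // scaleNr setUCA.
transitivity (\sum_(p | [&& p.1 \notin t, p.2 \notin t & p.1 != p.2]) F p.1 p.2).
  rewrite -(pair_big_dep (fun k => k \notin t)
    (fun k l => (l \notin t) && (k != l)) F) /=; apply: eq_bigr => k kt.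
  rewrite ffunE scaler_sumr; apply: eq_big => [l|l _]; last by rewrite scalerA.
  by rewrite !inE negb_or andbC eq_sym.
rewrite (bigID (fun p : 'I_n * 'I_n => (p.1 < p.2)%N)) /= addrC.
rewrite (reindex_inj (h := fun p : 'I_n * 'I_n => (p.2, p.1))) /=; last first.
  by move=> [? ?] [? ?] [-> ->].
apply/eqP; rewrite addr_eq0 -sumrN; apply/eqP; apply: eq_big => [[k l]|[k l]] /=.
  rewrite andbCA eq_sym -!andbA; do 2!congr (_ && _).
  by rewrite -(inj_eq val_inj) /=; case: ltngtP.
by case/andP=> /and3P[lt kt kl] _; rewrite Fa // eq_sym.
Qed.

(* Adding the vertex [j] is a contracting homotopy of the full simplex. *)
Lemma kbd_kcone j c : kbd (kcone j c) + kcone j (kbd c) = c.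
Proof.
apply/ffunP=> t; rewrite !ffunE; case: ifPn => [jt|jt].
  have jt' : j \notin t :\ j by rewrite !inE eqxx.
  rewrite scaler_sumr [X in _ + X](bigD1 j) //= setD1K // scalerA ksign_sqr scale1r.
  rewrite addrCA [X in _ + X](_ : _ = 0) ?addr0 //.
  rewrite [X in _ + X](eq_bigl (fun k => k \notin t)); last first.
    by move=> k; rewrite !inE; case: eqP => [->|_]; rewrite ?jt ?andbT.
  rewrite -big_split big1 // => k kt.
  have kj : k != j by apply: contraNneq kt => ->.
  rewrite ffunE !inE jt orbT.
  have -> : (k |: t) :\ j = k |: (t :\ j).
    by apply/setP=> x; rewrite !inE; case: eqP => // ->; rewrite [j == k]eq_sym (negbTE kj).
  rewrite /= !scalerA -scalerDl -{1}(setD1K jt) [X in X *: _](_ : _ = 0) ?scale0r //.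
  by rewrite ksign_swap ?addNr // !inE (negbTE kt) andbF.
rewrite addr0 (bigD1 j) //= ffunE !inE eqxx setU1K //= scalerA ksign_sqr scale1r.
rewrite big1 ?addr0 // => k /andP[kt kj].
by rewrite ffunE !inE eq_sym (negbTE kj) (negbTE jt) scaler0.
Qed.

Lemma kcone0 j : kcone j 0 = 0.
Proof. by apply/ffunP=> t; rewrite !ffunE scaler0 if_same. Qed.

(* Here [p] counts vertices: it is the dimension plus one. *)
Definition kchain (X : {set 'I_n} -> V -> Prop) (p : nat) c :=
  forall t, X t (c t) /\ (#|t| != p -> c t = 0).

Definition kacyclic (X : {set 'I_n} -> V -> Prop) (p : nat) :=
  forall z, kchain X p z -> kbd z = 0 ->
  exists2 w, kchain X p.+1 w & kbd w = z.

Lemma eq_kacyclic (X Y : {set 'I_n} -> V -> Prop) p :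
  (forall t v, X t v <-> Y t v) -> kacyclic X p -> kacyclic Y p.
Proof.
move=> XY aX z zY bz; have [|w wX <-] := aX z _ bz.
  by move=> t; have [/XY] := zY t.
by exists w => // t; have [/XY] := wX t.
Qed.

Definition suppsys (X : pred {set 'I_n}) t (v : V) : Prop := v = 0 \/ X t.

(** The contracting homotopy [kcone j] of the full simplex does not leave [X]. *)
Lemma kacyclic_cone (X : pred {set 'I_n}) j p :
  (forall t, X t -> X (j |: t)) -> kacyclic (suppsys X) p.
Proof.
move=> Xj z zX bz; exists (kcone j z); last first.
  by rewrite -[RHS](kbd_kcone j) bz kcone0 addr0.
move=> t; rewrite ffunE; case: ifPn => [jt|jt]; last by split=> //; left.
have [[->|Xt] sz] := zX (t :\ j); first by rewrite scaler0; split=> //; left.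
split; first by right; rewrite -(setD1K jt); apply: Xj.
move=> ct; rewrite sz ?scaler0 //; apply: contraNneq ct => <-.
by rewrite (cardsD1 j t) jt.
Qed.

(** Together with [klink], this splits a chain into its part avoiding [j] and the cone over its link
    at [j], the two components of a mapping cone. *)
Definition koff j c : {ffun {set 'I_n} -> V} :=
  [ffun t : {set 'I_n} => if j \in t then 0 else c t].

Definition klink j c : {ffun {set 'I_n} -> V} :=
  [ffun t : {set 'I_n} => if j \in t then 0 else ksign j t *: c (j |: t)].

Lemma koff_klink j c : koff j c + kcone j (klink j c) = c.
Proof.
apply/ffunP=> t; rewrite !ffunE; case: ifPn => jt; last by rewrite addr0.
by rewrite !inE eqxx /= scalerA ksign_sqr scale1r setD1K // add0r.
Qed.

Lemma kconeB j c1 c2 : kcone j (c1 - c2) = kcone j c1 - kcone j c2.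
Proof.
by apply/ffunP=> t; rewrite !ffunE; case: ifP => _; rewrite ?subr0 ?scalerBr.
Qed.

Lemma koff_kcone j c : koff j (kcone j c) = 0.
Proof. by apply/ffunP=> t; rewrite !ffunE; case: (j \in t). Qed.

Lemma koff_klink_id j c : koff j (klink j c) = klink j c.
Proof. by apply/ffunP=> t; rewrite !ffunE; case: (j \in t). Qed.

Lemma koff_id j c : koff j (koff j c) = koff j c.
Proof. by apply/ffunP=> t; rewrite !ffunE; case: (j \in t). Qed.

Lemma koffD j c1 c2 : koff j (c1 + c2) = koff j c1 + koff j c2.
Proof. by apply/ffunP=> t; rewrite !ffunE; case: ifP; rewrite ?addr0. Qed.

Lemma koffB j c1 c2 : koff j (c1 - c2) = koff j c1 - koff j c2.
Proof. by apply/ffunP=> t; rewrite !ffunE; case: ifP; rewrite ?subr0. Qed.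

Lemma koff_kbd_koff j c : koff j (kbd (koff j c)) = kbd (koff j c).
Proof.
apply/ffunP=> t; rewrite !ffunE; case: ifP => // jt.
by rewrite big1 // => k _; rewrite ffunE !inE jt orbT scaler0.
Qed.

Lemma kbd_kconeE j c : kbd (kcone j c) = c - kcone j (kbd c).
Proof. by rewrite -[X in X - _](kbd_kcone j) addrK. Qed.

Lemma koff_kbd j c : koff j (kbd c) = kbd (koff j c) + klink j c.
Proof.
rewrite -[X in kbd X](koff_klink j) kbdD koffD koff_kbd_koff kbd_kconeE.
by rewrite koffB koff_kcone subr0 koff_klink_id.
Qed.

Lemma klink_kbd j c : klink j (kbd c) = - kbd (klink j c).
Proof.
have E := congr1 (kbd) (koff_kbd j c).
rewrite kbdD kbd_kbd add0r in E; rewrite -E.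
have := koff_kbd j (kbd c); rewrite kbd_kbd => /eqP.
rewrite (_ : koff j 0 = 0); last by apply/ffunP=> t; rewrite !ffunE if_same.
by rewrite eq_sym addrC addr_eq0 => /eqP.
Qed.

Lemma koff_out j c t : j \in t -> koff j c t = 0.
Proof. by move=> jt; rewrite ffunE jt. Qed.

Lemma koff_in j c t : j \notin t -> koff j c t = c t.
Proof. by move=> jt; rewrite ffunE (negbTE jt). Qed.

Lemma kcone_klink_in j c t : j \in t -> kcone j (klink j c) t = c t.
Proof.
move=> jt; have /(congr1 (fun f : {ffun _ -> _} => f t)) := koff_klink j c.
by rewrite ffunE koff_out // add0r.
Qed.

Lemma kcone_out j c t : j \notin t -> kcone j c t = 0.
Proof. by move=> jt; rewrite ffunE (negbTE jt). Qed.

Lemma klink_out j c t : j \in t -> klink j c t = 0.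
Proof. by move=> jt; rewrite ffunE jt. Qed.

(** [U'] with a cone of apex [j] attached over [U]: the mapping cone of [U] in [U']. *)
Definition mixsys j (U U' : pred {set 'I_n}) : pred {set 'I_n} :=
  fun t => if j \in t then U (t :\ j) else U' t.

Lemma kchain_ofP (X : pred {set 'I_n}) p c :
  (forall t, c t != 0 -> X t /\ #|t| = p) <-> kchain (suppsys X) p c.
Proof.
split=> [H t|H t c0].
  have [->|/H[Xt ct]] := eqVneq (c t) 0; first by split=> //; left.
  by split; [right | rewrite ct eqxx].
have [[ct0|Xt] ct] := H t; first by rewrite ct0 eqxx in c0.
by split=> //; apply/eqP; apply: contraNT c0 => /ct ->.
Qed.

Lemma klink_neq0 j c t : klink j c t != 0 -> j \notin t /\ c (j |: t) != 0.
Proof.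
rewrite ffunE; case: ifP => [|/negbT jt ct]; first by rewrite eqxx.
by split=> //; apply: contraNneq ct => ->; rewrite scaler0.
Qed.

Lemma kcone_neq0 j c t : kcone j c t != 0 -> j \in t /\ c (t :\ j) != 0.
Proof.
rewrite ffunE; case: ifP => [jt ct|]; last by rewrite eqxx.
by split=> //; apply: contraNneq ct => ->; rewrite scaler0.
Qed.

Lemma chainD c1 c2 t : (c1 + c2) t = c1 t + c2 t.
Proof. by rewrite ffunE. Qed.

Lemma chainN c t : (- c) t = - c t.
Proof. by rewrite ffunE. Qed.

Lemma chainB c1 c2 t : (c1 - c2) t = c1 t - c2 t.
Proof. by rewrite !ffunE. Qed.

Section Triple.

Variables (j : 'I_n) (Ua Ub Uc : pred {set 'I_n}).
Hypotheses (ab : forall t, j \notin t -> Ua t -> Ub t)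
  (bc : forall t, j \notin t -> Ub t -> Uc t).
Let sys U U' := suppsys (mixsys j U U').

(* Modulo cones over [j], the three systems below compute the relative homology
   of the pairs in [Ua <= Ub <= Uc]; the next two lemmas are exactness of the
   long homology sequence of this triple at two of its terms. *)
Lemma kacyclic_triple_mid p :
  kacyclic (sys Ua Ub) p -> kacyclic (sys Ub Uc) p -> kacyclic (sys Ua Uc) p.
Proof.
move=> aab abc z /kchain_ofP zX bz.
have [w /kchain_ofP wX bw] : exists2 w, kchain (sys Ub Uc) p.+1 w & kbd w = z.
  apply: abc => //; apply/kchain_ofP => t /zX[]; rewrite /mixsys.
  by case: ifP => // jt Ut ->; split=> //; apply: ab; rewrite // !inE eqxx.
(* The link of [w] lies in [Ub], and its boundary is minus the link of [z], hence lies in [Ua];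
   coning off this boundary gives a cycle for the pair ([Ub], [Ua]). *)
pose w1 := klink j w; pose y := w1 - kcone j (kbd w1).
have [v /kchain_ofP vX bv] : exists2 v, kchain (sys Ua Ub) p.+1 v & kbd v = y.
  apply: aab; last by rewrite kbdB kbd_kconeE kbd_kbd kcone0 subr0 subrr.
  apply/kchain_ofP => t; rewrite chainB -[kbd w1]opprK -klink_kbd bw /mixsys.
  case: ifPn => jt; last first.
    rewrite kcone_out // subr0 => /klink_neq0[_ /wX[]].
    rewrite /mixsys !inE eqxx /= setU1K // => Ut.
    by rewrite cardsU1 jt => -[].
  rewrite klink_out // sub0r oppr_eq0 => /kcone_neq0[_].
  rewrite chainN oppr_eq0 => /klink_neq0[_]; rewrite setD1K // => /zX[].
  by rewrite /mixsys jt.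
exists (koff j w + v).
  apply/kchain_ofP => t; rewrite chainD /mixsys; case: ifPn => jt.
    by rewrite koff_out // add0r => /vX; rewrite /mixsys jt.
  rewrite koff_in //; have [v0|/vX[]] := eqVneq (v t) 0.
    by rewrite v0 addr0 => /wX; rewrite /mixsys (negbTE jt).
  by rewrite /mixsys (negbTE jt) => Ut ct _; split=> //; apply: bc.
have w1E : w1 = kbd (koff j v) + klink j v.
  by rewrite -koff_kbd bv koffB koff_kcone subr0 koff_klink_id.
(* The cone part of [w], too large for [Ua], is exchanged for [v]; this changes [w] only by a
   boundary. *)
suff -> : koff j w + v = w + kbd (kcone j (koff j v)).
  by rewrite kbdD bw kbd_kbd addr0.
rewrite kbd_kconeE -[in RHS](koff_klink j w) -[in LHS](koff_klink j v).
have -> : klink j v = w1 - kbd (koff j v) by rewrite w1E addrC addKr.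
by rewrite kconeB -!addrA; congr (_ + _); rewrite addrCA.
Qed.

Lemma kacyclic_triple_left p :
  kacyclic (sys Ua Uc) p -> kacyclic (sys Ub Uc) p.+1 -> kacyclic (sys Ua Ub) p.
Proof.
move=> aac abc z /kchain_ofP zX bz.
have [w /kchain_ofP wX bw] : exists2 w, kchain (sys Ua Uc) p.+1 w & kbd w = z.
  apply: aac => //; apply/kchain_ofP => t /zX[]; rewrite /mixsys.
  by case: ifPn => // jt Ut ->; split=> //; apply: bc.
(* Dually, the part of [w] avoiding [j] lies in [Uc] with boundary in [Ub], which gives a cycle for
   ([Uc], [Ub]); the link of its filling [v] will replace [w0]. *)
pose w0 := koff j w; pose y := w0 - kcone j (kbd w0).
have bw0 : kbd w0 = koff j z - klink j w by rewrite -bw koff_kbd addrK.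
have [v /kchain_ofP vX bv] : exists2 v, kchain (sys Ub Uc) p.+2 v & kbd v = y.
  apply: abc; last by rewrite kbdB kbd_kconeE kbd_kbd kcone0 subr0 subrr.
  apply/kchain_ofP => t; rewrite /y bw0 chainB /mixsys.
  case: ifPn => jt.
    rewrite koff_out // add0r oppr_eq0 => /kcone_neq0[_].
    have jt' : j \notin t :\ j by rewrite !inE eqxx.
    have ct : #|t| = #|t :\ j|.+1 by rewrite (cardsD1 j t) jt.
    rewrite chainB koff_in // [klink _ _ _]ffunE (negbTE jt') setD1K //.
    have [z0|/zX[]] := eqVneq (z (t :\ j)) 0.
      rewrite z0 sub0r oppr_eq0 => w0'.
      have /wX[] : w t != 0 by apply: contraNneq w0' => ->; rewrite scaler0.
      by rewrite /mixsys jt => /ab Ut ct'; split=> //; apply: Ut.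
    by rewrite /mixsys (negbTE jt') => Ut <- _.
  by rewrite koff_in // kcone_out // subr0 => /wX; rewrite /mixsys (negbTE jt).
exists (klink j v + kcone j (klink j w)).
  apply/kchain_ofP => t; rewrite chainD /mixsys; case: ifPn => jt.
    rewrite kcone_klink_in // klink_out // add0r => /wX.
    by rewrite /mixsys jt.
  rewrite kcone_out // addr0 => /klink_neq0[_ /vX[]].
  by rewrite /mixsys !inE eqxx setU1K // cardsU1 jt => Ut [].
have w0E : w0 = kbd (koff j v) + klink j v.
  by rewrite -koff_kbd bv koffB koff_kcone subr0 /w0 koff_id.
suff -> : klink j v + kcone j (klink j w) = w - kbd (koff j v).
  by rewrite kbdB kbd_kbd subr0.
by rewrite -[in RHS](koff_klink j w) -/w0 w0E addrAC [kbd _ + _]addrC addrK.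
Qed.

End Triple.

End SimplexChains.

(** * Box homology and symbolic powers *)

Section BoxHomology.

Variables (K : fieldType) (n : nat) (V : lmodType K).
Implicit Types (a b c : 'X_{1..n}) (t : {set 'I_n}) (j : 'I_n).

Definition mnm_mix t a b : 'X_{1..n} :=
  [multinom if i \in t then a i else b i | i < n].

Definition mnm_upd a j x : 'X_{1..n} :=
  [multinom if i == j then x else a i | i < n].

Definition mnm_succ a : 'X_{1..n} := [multinom (a i).+1 | i < n].

Definition mnm_cst (N : nat) : 'X_{1..n} := [multinom N | i < n].

Section Fixed.

Variable Q : pred 'X_{1..n}.
Hypothesis Qmono : forall c c', (c <= c')%MM -> Q c -> Q c'.

(** A face [t] is the corner at the lower ends in the directions of [t] and at the upper ends
    elsewhere. When [a <= b], monotonicity of [Q] makes these faces a simplicial complex. *)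
Definition boxsys a b := suppsys (V := V) (fun t => Q (mnm_mix t a b)).

Let slice a b j x t := Q (mnm_upd (mnm_mix t a b) j x).

Lemma slice_mono a b j x y t : (x <= y)%N -> slice a b j x t -> slice a b j y t.
Proof.
move=> xy; apply: Qmono; apply/mnm_lepP=> i; rewrite !mnmE.
by case: eqP.
Qed.

(** In direction [j] the box is the mapping cone of its lower slice in its upper slice. Moving the
    ends of that one interval therefore only changes the pair, and three positions give a triple. *)
Lemma boxsys_slice a b a' b' j p :
  (forall i, i != j -> a i = a' i /\ b i = b' i) ->
  kacyclic (boxsys a' b') p <->
  kacyclic (suppsys (V := V)
    (mixsys j (slice a b j (a' j)) (slice a b j (b' j)))) p.
Proof.
move=> ab; have E t : mixsys j (slice a b j (a' j)) (slice a b j (b' j)) t =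
    Q (mnm_mix t a' b').
  rewrite /mixsys /slice; case: ifPn => jt; congr Q; apply/mnmP=> i;
    rewrite !mnmE; case: eqP => [->|/eqP ij]; rewrite ?jt ?(negbTE jt) //.
    by have [<- <-] := ab i ij; rewrite !inE ij.
  by have [<- <-] := ab i ij.
by split; apply: eq_kacyclic => t v; rewrite /boxsys /suppsys E.
Qed.

Lemma boxsys_mid a b j x p : (a j <= x <= b j)%N ->
  kacyclic (boxsys a (mnm_upd b j x)) p ->
  kacyclic (boxsys (mnm_upd a j x) b) p -> kacyclic (boxsys a b) p.
Proof.
case/andP=> ax xb.
rewrite !(@boxsys_slice a b _ _ j); try by move=> i /negbTE ij; rewrite ?mnmE ?ij.
rewrite !mnmE eqxx => H1 H2.
by apply: (kacyclic_triple_mid _ _ H1 H2) => t _; apply: slice_mono.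
Qed.

Lemma boxsys_left a b j x p : (a j <= b j <= x)%N ->
  kacyclic (boxsys a (mnm_upd b j x)) p ->
  kacyclic (boxsys (mnm_upd a j (b j)) (mnm_upd b j x)) p.+1 ->
  kacyclic (boxsys a b) p.
Proof.
case/andP=> ax xb.
rewrite !(@boxsys_slice a b _ _ j); try by move=> i /negbTE ij; rewrite ?mnmE ?ij.
rewrite !mnmE eqxx => H1 H2.
by apply: (kacyclic_triple_left _ _ H1 H2) => t _; apply: slice_mono.
Qed.

(* Widening every unit interval [a i, a i + 1] to [a i, N] keeps a homology
   class alive at the cost of raising the degree and the lower corner by the
   same amount. *)
Lemma boxsys_widen a N p : (forall i, a i < N)%N ->
  ~ kacyclic (boxsys a (mnm_succ a)) p ->
  exists c q, ~ kacyclic (boxsys c (mnm_cst N)) q /\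
    (mdeg c + p = mdeg a + q)%N.
Proof.
move=> aN nv.
pose top k c := [multinom if (i < k)%N then N else (c i).+1 | i < n].
suff H k : (k <= n)%N -> exists c q, (forall i : 'I_n, (k <= i)%N -> c i = a i) /\
    (~ kacyclic (boxsys c (top k c)) q) /\ (mdeg c + p = mdeg a + q)%N.
  have [c [q [_ [nvc E]]]] := H n (leqnn n).
  exists c, q; split=> //; rewrite (_ : mnm_cst N = top n c) //.
  by apply/mnmP=> i; rewrite !mnmE ltn_ord.
elim: k => [|k IH] kn.
  by exists a, p.
have [c [q [ca [nvc E]]]] := IH (ltnW kn).
pose j := Ordinal kn; have cj : c j = a j by apply: ca.
have tj : top k c j = (c j).+1 by rewrite !mnmE /= ltnn.
(* If the class dies when interval [j] is stretched, the connecting map moves it to [c j + 1, N] one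
   homological degree higher, so that [mdeg c - q] is unchanged. *)
have [H1|H1] := pselect (kacyclic (boxsys c (mnm_upd (top k c) j N)) q).
  exists (mnm_upd c j (c j).+1), q.+1; split; last split.
  - move=> i ki; rewrite !mnmE; case: eqP => [ij|_]; last by apply: ca; apply: ltnW.
    by move: ki; rewrite ij /= ltnn.
  - move=> H2; apply: nvc; apply: (@boxsys_left _ _ j N) => //.
      by rewrite tj leqnSn /= cj.
    rewrite tj (_ : mnm_upd (top k c) j N = top k.+1 (mnm_upd c j (c j).+1)) //.
    apply/mnmP=> i; rewrite !mnmE ltnS [(i <= k)%N]leq_eqVlt (_ : (i == k :> nat) = (i == j)) //.
    by case: eqP.
  - rewrite (_ : mnm_upd c j (c j).+1 = (c + U_(j))%MM).
      by rewrite mdegD mdeg1; lia.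
    by apply/mnmP=> i; rewrite mnmDE mnm1E !mnmE eq_sym; case: eqP => [->|_]; rewrite ?addn1 ?addn0.
exists c, q; split; last split=> //.
  by move=> i ki; apply: ca; apply: ltnW.
rewrite (_ : top k.+1 c = mnm_upd (top k c) j N) //.
apply/mnmP=> i; rewrite !mnmE ltnS [(i <= k)%N]leq_eqVlt (_ : (i == k :> nat) = (i == j)) //.
by case: eqP.
Qed.

Lemma boxsys_shrink a b p : (forall i, a i < b i)%N ->
  ~ kacyclic (boxsys a b) p ->
  exists2 c, (a <= c)%MM & ~ kacyclic (boxsys c (mnm_succ c)) p.
Proof.
have [N] := ubnP (mdeg b - mdeg a)%N.
elim: N a b => // N IH a b leN ab nv.
have [E|nab] := eqVneq (mnm_succ a) b.
  by exists a; [apply: lepm_refl | rewrite E].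
have [j ajb] : exists j, ((a j).+1 < b j)%N.
  apply/existsP; apply: contraNT nab; rewrite negb_exists => /forallP H.
  apply/eqP/mnmP=> i; rewrite !mnmE; apply/eqP; rewrite eqn_leq ab.
  by rewrite leqNgt H.
have mB (c c' : 'X_{1..n}) : (c <= c')%MM -> mdeg c' = (mdeg c + mdeg (c' - c)%MM)%N.
  by move=> le; rewrite -mdegD addmC submK.
have mlt (c c' : 'X_{1..n}) i : (c <= c')%MM -> (c i < c' i)%N -> (mdeg c < mdeg c')%N.
  move=> le lt; rewrite (mB _ _ le) -[X in (X < _)%N]addn0 ltn_add2l lt0n mdeg_eq0.
  by apply/eqP => /mnmP/(_ i); rewrite mnmBE mnm0E; lia.
have mle (c c' : 'X_{1..n}) : (c <= c')%MM -> (mdeg c <= mdeg c')%N.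
  by move=> le; rewrite (mB _ _ le) leq_addr.
(* Interval [j] is cut at [a j + 1]. One of the two pieces keeps a class in the same homological
   degree [p], and the lower corner can only rise. *)
have [H1|H1] := pselect (kacyclic (boxsys a (mnm_upd b j (a j).+1)) p).
  have [|||c ac nvc] := IH (mnm_upd a j (a j).+1) b.
  - have: (mdeg (mnm_upd a j (a j).+1) <= mdeg b)%N.
      by apply: mle; apply/mnm_lepP=> i; rewrite !mnmE; case: eqP => [->|_]; apply: ltnW.
    have: (mdeg a < mdeg (mnm_upd a j (a j).+1))%N.
      apply: (@mlt _ _ j); rewrite ?mnmE ?eqxx //.
      by apply/mnm_lepP=> i; rewrite mnmE; case: eqP => // ->.
    by lia.
  - by move=> i; rewrite !mnmE; case: eqP => [->|].
  - move=> H2; apply: nv; apply: boxsys_mid H1 H2.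
    by rewrite leqnSn /= ltnW.
  exists c => //; apply: lepm_trans ac; apply/mnm_lepP=> i; rewrite !mnmE.
  by case: eqP => // ->.
have [||c ac nvc] := IH a (mnm_upd b j (a j).+1) _ _ H1; last 1 first.
- by exists c.
- have: (mdeg a <= mdeg (mnm_upd b j (a j).+1))%N.
    by apply: mle; apply/mnm_lepP=> i; rewrite !mnmE; case: eqP => [->|_] //; apply: ltnW.
  have: (mdeg (mnm_upd b j (a j).+1) < mdeg b)%N.
    apply: (@mlt _ _ j); rewrite ?mnmE ?eqxx //; apply/mnm_lepP=> i; rewrite mnmE.
    by case: eqP => // ->; apply: ltnW.
  by lia.
- by move=> i; rewrite !mnmE; case: eqP => [->|].
Qed.

End Fixed.

(** * Stretched boxes of symbolic powers *)

Variable PP : pred {set 'I_n}.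

(* Coordinate [0] stands for exponent [-oo], coordinate [e + 1] for exponent [e]. *)
Definition sympred (m : nat) : pred 'X_{1..n} := fun c =>
  [forall j, (0 < c j)%N] &&
  [forall (P : {set 'I_n} | PP P), (m <= \sum_(j in P) (c j).-1)%N].

Lemma sympred_mono m c c' : (c <= c')%MM -> sympred m c -> sympred m c'.
Proof.
move=> /mnm_lepP le /andP[/forallP c0 /forall_inP cP]; apply/andP; split.
  by apply/forallP=> j; apply: leq_trans (c0 j) (le j).
apply/forall_inP=> P /cP H; apply: leq_trans H _; apply: leq_sum => j _.
by have := le j; lia.
Qed.

(** An upper end [N] stands for the exponent [N - 1 >= m], so one coordinate outside [t] already
    gives [P] enough weight. *)
Lemma sympred_top m N a t : (m < N)%N ->
  sympred m (mnm_mix t a (mnm_cst N)) =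
  [forall j in t, (0 < a j)%N] && [forall (P : {set 'I_n} | PP P && (P \subset t)),
    (m <= \sum_(j in P) (a j).-1)%N].
Proof.
move=> mN; rewrite /sympred; congr (_ && _).
  apply/forallP/forall_inP => H j; first by move=> jt; have := H j; rewrite mnmE jt.
  by rewrite !mnmE; case: ifP => [/H//|_]; lia.
apply/forall_inP/forall_inP => H P.
  case/andP=> /H le Pt; apply: leq_trans le _; rewrite leq_eqVlt; apply/orP; left.
  by apply/eqP/eq_bigr => j /(subsetP Pt) jt; rewrite mnmE jt.
move=> PPP; have [Pt|/subsetPn[j jP jt]] := boolP (P \subset t).
  apply: leq_trans (H P _) _; first by rewrite PPP.
  rewrite leq_eqVlt; apply/orP; left.
  by apply/eqP/eq_bigr => j /(subsetP Pt) jt; rewrite mnmE jt.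
rewrite (bigD1 j) //= !mnmE (negbTE jt); lia.
Qed.

Lemma sympred_top_eq m m' N N' a a' t : (m < N)%N -> (m' < N')%N ->
  (forall j, (0 < a j)%N = (0 < a' j)%N) ->
  (forall P : {set 'I_n}, PP P -> (forall j, j \in P -> (0 < a j)%N) ->
    (m <= \sum_(j in P) (a j).-1)%N = (m' <= \sum_(j in P) (a' j).-1)%N) ->
  sympred m (mnm_mix t a (mnm_cst N)) = sympred m' (mnm_mix t a' (mnm_cst N')).
Proof.
move=> mN mN' a0 aP; rewrite !sympred_top //.
rewrite (eq_forallb_in (P2 := fun j => (0 < a' j)%N)); last by move=> j _; rewrite a0.
case: forall_inP => //= H; apply: eq_forallb_in => P /andP[PPP Pt].
by apply: aP => // j /(subsetP Pt) jt; rewrite a0 H.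
Qed.

Lemma sum_delta_le (P : {set 'I_n}) j0 x :
  (\sum_(i in P) (i == j0) * x <= x)%N.
Proof.
have [jP|jP] := boolP (j0 \in P).
  rewrite (bigD1 j0) //= eqxx big1 ?addn0 ?mul1n //.
  by move=> i /andP[_ /negbTE->].
by rewrite big1 // => i iP; case: eqP jP => // <-; rewrite iP.
Qed.

Definition sym_nv m c p : Prop := ~ kacyclic (boxsys (sympred m) c (mnm_succ c)) p.

Lemma sym_nv_transfer m m' d :
  (forall a j0, (0 < a j0)%N -> exists a', [/\ (mdeg a + d <= mdeg a')%N,
     (forall j, (0 < a j)%N = (0 < a' j)%N) &
     forall P : {set 'I_n}, PP P -> (forall j, j \in P -> (0 < a j)%N) ->
     (m <= \sum_(j in P) (a j).-1)%N = (m' <= \sum_(j in P) (a' j).-1)%N]) ->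
  forall c p, (p < mdeg c)%N -> sym_nv m c p ->
  exists c' p', sym_nv m' c' p' /\ (mdeg c + p' + d <= mdeg c' + p)%N.
Proof.
move=> H c p pc nv.
pose N := (m + mdeg c).+2.
have [|a [q [nva aE]]] := boxsys_widen (@sympred_mono m) (N := N) _ nv.
  move=> i; rewrite /N mdegE (bigD1 i) //=; lia.
(* By [aE] and [p < mdeg c] the degree of [a] is positive. The coordinate [j0] thus stands for an
   actual exponent, and raising it does not alter which coordinates are -oo. *)
have [j0 a0] : exists j0, (0 < a j0)%N.
  apply/existsP; apply: contraT; rewrite negb_exists => /forallP a0.
  have : mdeg a = 0%N by rewrite mdegE big1 // => i _; have := a0 i; lia.
  lia.
have [a' [da a0' aP]] := H a j0 a0.
pose N' := (m' + mdeg a').+2.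
have nva' : ~ kacyclic (boxsys (sympred m') a' (mnm_cst N')) q.
  move=> H'; apply: nva; apply: eq_kacyclic H' => t v; rewrite /boxsys /suppsys.
  by rewrite (@sympred_top_eq m m' N N' a a') // /N /N'; lia.
have [|c' ac' nvc'] := boxsys_shrink (@sympred_mono m') _ nva'.
  move=> i; rewrite !mnmE /N' mdegE (bigD1 i) //=; lia.
exists c', q; split=> //.
have : (mdeg a' <= mdeg c')%N by rewrite -(submK ac') mdegD leq_addl.
lia.
Qed.

Lemma sym_nv_mul k m c p : (0 < k)%N -> (0 < m)%N -> (p < mdeg c)%N ->
  sym_nv m c p ->
  exists c' p', sym_nv (k * m) c' p' /\
    (mdeg c + p' + (k - 1) * m <= mdeg c' + p)%N.
Proof.
move=> k0 m0; apply: sym_nv_transfer => a j0 a0.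
(* [s] counts the coordinates that are not -oo and [B] adds up their exponents. *)
pose s := (\sum_j (0 < a j)%N)%N; pose B := (\sum_j (a j).-1)%N.
have aE : mdeg a = (B + s)%N.
  rewrite mdegE /B /s -big_split; apply: eq_bigr => j _ /=; lia.
have [le|gt] := leqP m.-1 B.
  (* For integers y and x <= k - 1, m <= y iff k m <= k y + x. The degree grows by (k - 1)(B + 1),
     which is at least (k - 1) m because m - 1 <= B. *)
  pose f j := (k * (a j).-1 + (j == j0) * k.-1)%N.
  exists [multinom ((0 < a j) * (f j).+1)%N | j < n]; split.
  - rewrite [in X in (_ <= X)%N]mdegE.
    rewrite (eq_bigr (fun j => (k * (a j).-1 + ((j == j0) * k.-1 + (0 < a j)))%N)); last first.
      move=> j _; rewrite mnmE /f; case: eqP => [->|_]; first by rewrite a0; lia.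
      by case: (a j) => [|x] /=; lia.
    rewrite big_split big_split /= -big_distrr /= -/B -/s (bigD1 j0) //= eqxx.
    rewrite big1 => [|j /negbTE->]; last by rewrite mul0n.
    by rewrite aE mul1n; nia.
  - by move=> j; rewrite mnmE; case: (0 < a j)%N.
  move=> P PPP aP.
  rewrite [in RHS](eq_bigr (fun j => (k * (a j).-1 + (j == j0) * k.-1)%N)); last first.
    by move=> j jP; rewrite mnmE aP // mul1n.
  rewrite big_split /= -big_distrr /=.
  have := sum_delta_le P j0 k.-1.
  move: (\sum_(i in P) (i == j0) * k.-1)%N (\sum_(i in P) (a i).-1)%N => x y xk.
  by have [my|ym] := leqP m y; apply/esym; [apply/idP; nia | apply/negbTE; rewrite -ltnNge; nia].
(* With B < m - 1 no prime reaches its threshold, so the exponents may be replaced by m - 1 at [j0]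
   and 0 elsewhere. The recipe of the first case then gives k (m - 1) + (k - 1) = k m - 1 at
   [j0]. *)
exists [multinom ((0 < a j) + (j == j0) * (k * m).-1)%N | j < n]; split.
- rewrite [in X in (_ <= X)%N]mdegE.
  rewrite (eq_bigr (fun j => ((0 < a j) + (j == j0) * (k * m).-1)%N)); last first.
    by move=> j _; rewrite mnmE.
  rewrite big_split /= -/s [X in (_ <= _ + X)%N](bigD1 j0) //= eqxx.
  rewrite big1 => [|j /negbTE->]; last by rewrite mul0n.
  by rewrite aE mul1n; nia.
- move=> j; rewrite mnmE; case: eqP => [->|_]; first by rewrite a0.
  by case: (0 < a j)%N.
move=> P PPP aP.
have : (\sum_(j in P) (a j).-1 <= B)%N.
  by rewrite /B [X in (_ <= X)%N](bigID (mem P)) /= leq_addr.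
rewrite [in RHS](eq_bigr (fun j => ((j == j0) * (k * m).-1)%N)); last first.
  by move=> j jP; rewrite mnmE aP.
have := sum_delta_le P j0 (k * m).-1.
move: (\sum_(i in P) (i == j0) * (k * m).-1)%N (\sum_(i in P) (a i).-1)%N => x y xk yB.
apply/idP/idP; nia.
Qed.

Lemma sym_nv_23 c p : (p < mdeg c)%N -> sym_nv 2 c p ->
  exists c' p', sym_nv 3 c' p' /\ (mdeg c + p' + 1 <= mdeg c' + p)%N.
Proof.
apply: sym_nv_transfer => a j0 a0.
pose s := (\sum_j (0 < a j)%N)%N; pose B := (\sum_j (a j).-1)%N.
have aE : mdeg a = (B + s)%N.
  rewrite mdegE /B /s -big_split; apply: eq_bigr => j _ /=; lia.
have [le|gt] := leqP 1 B.
  (* For integers 2 <= y iff 3 <= 2 y; doubling gains B >= 1. *)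
  exists [multinom (2 * (a j).-1 + (0 < a j))%N | j < n]; split.
  - rewrite [in X in (_ <= X)%N]mdegE.
    rewrite (eq_bigr (fun j => (2 * (a j).-1 + (0 < a j))%N)); last first.
      by move=> j _; rewrite mnmE.
    by rewrite big_split /= -big_distrr /= -/B -/s; lia.
  - by move=> j; rewrite mnmE; lia.
  move=> P PPP aP.
  rewrite [in RHS](eq_bigr (fun j => (2 * (a j).-1)%N)); last first.
    by move=> j jP; rewrite mnmE aP //= addn1.
  rewrite -big_distrr /=; lia.
(* All exponents are 0 here. The exponent 2 put at [j0] leaves every weight below 3. *)
exists (a + (U_(j0) + U_(j0)))%MM; split.
- by rewrite !mdegD !mdeg1; lia.
- move=> j; rewrite !mnmDE mnm1E; case: eqP => [<-|_]; lia.
move=> P PPP aP.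
have : (\sum_(j in P) (a j).-1 <= B)%N.
  by rewrite /B [X in (_ <= X)%N](bigID (mem P)) /= leq_addr.
rewrite [in RHS](eq_bigr (fun j => ((a j).-1 + (j == j0) * 2)%N)); last first.
  move=> j jP; rewrite !mnmDE mnm1E eq_sym; have := aP j jP; lia.
rewrite big_split /=.
have := sum_delta_le P j0 2.
move: (\sum_(i in P) (i == j0) * 2)%N (\sum_(i in P) (a i).-1)%N => x y x2 yB.
apply/idP/idP; lia.
Qed.

End BoxHomology.

(** * Multigraded minimal resolutions by scalar matrices *)

Section Mnm.

Variable n : nat.
Implicit Types (a b : 'X_{1..n}) (t : {set 'I_n}).

Definition mset t : 'X_{1..n} := [multinom (i \in t : nat) | i < n].

Lemma mset0 : mset set0 = 0%MM.
Proof. by apply/mnmP=> i; rewrite !mnmE in_set0. Qed.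

Lemma mset1 j : mset [set j] = U_(j)%MM.
Proof. by apply/mnmP=> i; rewrite !mnmE in_set1 eq_sym. Qed.

Lemma mset_mono t t' : t \subset t' -> (mset t <= mset t')%MM.
Proof.
move=> /subsetP tt; apply/mnm_lepP=> i; rewrite !mnmE.
by case: (boolP (i \in t)) => // /tt ->.
Qed.

Lemma lem_add_sub a b c : (b <= c)%MM -> (a <= c - b)%MM = (a + b <= c)%MM.
Proof.
move=> /mnm_lepP bc; apply/mnm_lepP/mnm_lepP => H i; move: (H i) (bc i);
  rewrite !mnmE; lia.
Qed.

Lemma lem_add_r a b c : (a + b <= c)%MM -> (b <= c)%MM.
Proof. by apply: lepm_trans; apply: lem_addl. Qed.

Lemma lem_anti a b : (a <= b)%MM -> (b <= a)%MM -> a = b.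
Proof.
move=> /mnm_lepP ab /mnm_lepP ba; apply/mnmP=> i; move: (ab i) (ba i); lia.
Qed.

Lemma mdeg_subU a j : (0 < a j)%N -> (mdeg (a - U_(j))%MM < mdeg a)%N.
Proof.
rewrite lt0n -lep1mP => aj; rewrite -{2}(submK aj) mdegD mdeg1; lia.
Qed.

Lemma lem_subU a b : (a <= b)%MM -> a != b ->
  exists2 j, (0 < b j)%N & (a <= b - U_(j))%MM.
Proof.
move=> ab nab; have [j abj] : exists j, (a j < b j)%N.
  apply/existsP; apply: contraNT nab; rewrite negb_exists => /forallP H.
  apply/eqP/lem_anti => //; apply/mnm_lepP=> i; by rewrite leqNgt H.
exists j; first by lia.
apply/mnm_lepP=> i; rewrite mnmBE mnm1E; move/mnm_lepP: ab => /(_ i).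
by case: eqP => [<-|_]; lia.
Qed.

End Mnm.

Section Stages.

Variables (K : fieldType) (n B : nat).
Implicit Types (a b : 'X_{1..n}) (t : {set 'I_n}).

(* A multigraded submodule of a free module with basis degrees [ms_lab]: the
   component of degree [a] is the row space of [ms_mod a], and multiplication
   by a monomial is an inclusion of row spaces. *)
Record mstage := MStage {
  ms_rank : nat;
  ms_lab : 'I_ms_rank -> 'X_{1..n};
  ms_mod : 'X_{1..n} -> 'M[K]_ms_rank }.

(** The projection whose row space is the degree [a] component of the free module with basis degrees
    [lab]. *)
Definition free_mx r (lab : 'I_r -> 'X_{1..n}) a : 'M[K]_r :=
  diag_mx (\row_i (lab i <= a)%MM%:R).

Lemma free_mxP r (lab : 'I_r -> 'X_{1..n}) a (v : 'rV[K]_r) :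
  reflect (forall i, v 0 i != 0 -> (lab i <= a)%MM) (v <= free_mx lab a)%MS.
Proof.
have E (w : 'rV_r) i : (w *m free_mx lab a) 0 i = w 0 i * (lab i <= a)%MM%:R.
  by rewrite mul_mx_diag !mxE.
apply: (iffP idP) => [/submxP[w ->] i|H].
  by rewrite E; case: (lab i <= a)%MM => //; rewrite mulr0 eqxx.
apply/submxP; exists v; apply/rowP=> i; rewrite E.
have [->|/H ->] := eqVneq (v 0 i) 0; by rewrite ?mul0r ?mulr1.
Qed.

Lemma free_mx_mono r (lab : 'I_r -> 'X_{1..n}) a b : (a <= b)%MM ->
  (free_mx lab a <= free_mx lab b)%MS.
Proof.
move=> ab; apply/rV_subP=> v /free_mxP H; apply/free_mxP=> i /H.
by move=> la; apply: lepm_trans ab.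
Qed.

(** * Minimal generators and syzygies of a multigraded module *)

Section Generators.

Variable S : mstage.

(** The component of (x_1,...,x_n)M in degree [a]; a complement of it in [ms_mod S a] is spanned by
    the minimal generators of that degree. *)
Definition dec_mx a : 'M[K]_(ms_rank S) :=
  (\sum_(j | (0 < a j)%N) ms_mod S (a - U_(j)))%MS.

Definition new_mx a : 'M[K]_(ms_rank S) := (ms_mod S a :\: dec_mx a)%MS.

(** Only degrees below [B] are listed, which makes the type finite; for valid stages [ms_bound]
    excludes generators in all other degrees. *)
Definition gen_type : finType := {a : 'X_{1..n < B} & 'I_(\rank (new_mx a))}.

Definition gen_mk (b : 'X_{1..n < B}) (j : 'I_(\rank (new_mx b))) : gen_type :=
  Tagged (fun b : 'X_{1..n < B} => 'I_(\rank (new_mx b))) j.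

Lemma gen_mkK (s : gen_type) : gen_mk (tagged s) = s.
Proof. by case: s. Qed.

Definition gen_row (s : gen_type) : 'rV[K]_(ms_rank S) :=
  row (tagged s) (row_base (new_mx (tag s))).

Definition gen_lab (i : 'I_#|gen_type|) : 'X_{1..n} := tag (enum_val i).

Definition gen_mx : 'M[K]_(#|gen_type|, ms_rank S) :=
  \matrix_i gen_row (enum_val i).

Definition syz_mod a : 'M[K]_#|gen_type| :=
  (free_mx gen_lab a :&: kermx gen_mx)%MS.

Definition ms_next : mstage := MStage gen_lab syz_mod.

End Generators.

(* Chains of the Koszul complex of the module [M], in multidegree [a]. *)
Definition ksys r (M : 'X_{1..n} -> 'M[K]_r) a (t : {set 'I_n}) (v : 'rV[K]_r) :=
  v = 0 \/ (mset t <= a)%MM /\ (v <= M (a - mset t)%MM)%MS.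

Definition in_free r (lab : 'I_r -> 'X_{1..n}) a t (v : 'rV[K]_r) :=
  forall i, v 0 i != 0 -> (lab i + mset t <= a)%MM.

Lemma in_freeP r (lab : 'I_r -> 'X_{1..n}) a t v :
  ksys (free_mx lab) a t v <-> in_free lab a t v.
Proof.
split=> [[->|[ta /free_mxP H]] i|H]; first by rewrite mxE eqxx.
  by move=> /H; rewrite lem_add_sub.
have [->|/rV0Pn[i vi]] := eqVneq v 0; first by left.
have ta := lem_add_r (H i vi).
by right; split=> //; apply/free_mxP=> k /H; rewrite lem_add_sub.
Qed.

(** The bound concerns Koszul homology in every homological degree [p], since it has to pass to all
    later syzygy modules. *)
Record ms_valid (S : mstage) : Prop := MSValid {
  ms_mono : forall a b, (a <= b)%MM -> (ms_mod S a <= ms_mod S b)%MS;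
  ms_sub : forall a, (ms_mod S a <= free_mx (@ms_lab S) a)%MS;
  ms_bound : forall a p, (B <= mdeg a)%N -> kacyclic (ksys (ms_mod S) a) p }.

(** The Koszul homology in homological degree 0 is M/(x_1,...,x_n)M. *)
Lemma kacyclic0P r (M : 'X_{1..n} -> 'M[K]_r) a :
  kacyclic (ksys M a) 0 <->
  (M a <= \sum_(j | (0 < a j)%N) M (a - U_(j))%MM)%MS.
Proof.
split=> [acy|/rV_subP dec].
  apply/rV_subP=> v va.
  pose z : {ffun {set 'I_n} -> 'rV[K]_r} := [ffun t => if t == set0 then v else 0].
  have [||w wM bw] := acy z.
  - move=> t; rewrite ffunE; case: eqP => [->|/eqP t0]; last by split=> //; left.
    rewrite cards0; split=> //; right; rewrite mset0 subm0.
    by split=> //; apply/mnm_lepP=> i; rewrite mnm0E.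
  - apply/ffunP=> t; rewrite !ffunE big1 // => k kt; rewrite ffunE.
    by case: eqP => [/setP/(_ k)|_]; rewrite ?scaler0 // !inE eqxx.
  have -> : v = kbd w set0 by rewrite bw ffunE eqxx.
  rewrite ffunE; apply: summx_sub => k _; apply: scalemx_sub.
  rewrite setU0; have [[->|[ak ww]] _] := wM [set k]; first exact: sub0mx.
  rewrite mset1 lep1mP -lt0n in ak ww.
  by apply: (sumsmx_sup k).
move=> z zM _; have [z0|[_ zin]] := (zM set0).1.
  exists 0; last first.
    rewrite (_ : z = 0); last first.
      apply/ffunP=> t; rewrite [RHS]ffunE; have [->//|t0] := eqVneq t set0.
      by apply: (zM t).2; rewrite cards_eq0.
    by apply/ffunP=> t; rewrite !ffunE big1 // => k _; rewrite ffunE scaler0.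
  by move=> t; rewrite ffunE; split=> //; left.
move: zin; rewrite mset0 subm0 => /dec/sub_sumsmxP[u zE].
pose pk (t : {set 'I_n}) := [pick k | (0 < a k)%N && (t == [set k])].
pose w : {ffun {set 'I_n} -> 'rV[K]_r} := [ffun t =>
  if pk t is Some k then ksign K k set0 *: (u k *m M (a - U_(k))%MM) else 0].
have w1 k : w [set k] = if (0 < a k)%N then
    ksign K k set0 *: (u k *m M (a - U_(k))%MM) else 0.
  rewrite ffunE /pk; case: pickP => [x /andP[ax /eqP/set1_inj ->]|/(_ k)].
    by rewrite ax.
  by rewrite eqxx andbT => ->.
exists w.
  move=> t; rewrite ffunE /pk; case: pickP => [k /andP[ak /eqP->]|_]; last first.
    by split=> //; left.
  rewrite cards1; split=> //; right; rewrite mset1 lep1mP -lt0n; split=> //.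
  by rewrite scalemx_sub // submxMl.
apply/ffunP=> t; have [->|t0] := eqVneq t set0.
  rewrite ffunE zE [RHS]big_mkcond /= big_mkcond /=.
  apply: eq_bigr => k _; rewrite in_set0 /= setU0 w1.
  by case: ifP => _; rewrite ?scaler0 // scalerA ksign_sqr scale1r.
rewrite (zM t).2 ?cards_eq0 // ffunE big1 // => k kt.
rewrite ffunE /pk; case: pickP => [x /andP[_ /eqP E]|_]; last by rewrite scaler0.
have /set0Pn[y yt] := t0.
have : y \in [set x] by rewrite -E !inE yt orbT.
have : k \in [set x] by rewrite -E !inE eqxx.
by rewrite !inE => /eqP kx /eqP yx; move: kt; rewrite kx -yx yt.
Qed.

Section Step.

Variable S : mstage.
Hypothesis SV : ms_valid S.

Let D := gen_mx S.
Let lab := @gen_lab S.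

Lemma gen_row_sub i : (row i D <= new_mx S (lab i))%MS.
Proof. by rewrite rowK (submx_trans (row_sub _ _)) // eq_row_base. Qed.

Lemma new_mx_sub a : (new_mx S a <= ms_mod S a)%MS.
Proof. exact: diffmxSl. Qed.

(** Graded Nakayama lemma, by induction on the degree; from degree [B] on, everything is
    decomposable. *)
Lemma gen_surj a : (ms_mod S a :=: free_mx lab a *m D)%MS.
Proof.
apply/eqmxP/andP; split; last first.
  apply/rV_subP=> _ /submxP[u ->]; rewrite mulmxA mulmx_sum_row.
  apply: summx_sub => i _.
  have [->|ui] := eqVneq ((u *m free_mx lab a) 0 i) 0.
    by rewrite scale0r sub0mx.
  apply: scalemx_sub; apply: submx_trans (gen_row_sub i) _.
  apply: submx_trans (new_mx_sub _) _; apply: (ms_mono SV).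
  have := submxMl u (free_mx lab a); move/free_mxP; exact.
have [N] := ubnP (mdeg a); elim: N a => // N IH a aN.
have Hdec : (dec_mx S a <= free_mx lab a *m D)%MS.
  apply/sumsmx_subP=> j aj; apply: submx_trans (IH _ _) _.
    by have := mdeg_subU aj; lia.
  by apply: submxMr; apply: free_mx_mono; apply: lem_subr.
have [aB|Ba] := ltnP (mdeg a) B; last first.
  by apply: submx_trans Hdec; have := ms_bound SV (p := 0) Ba; move/kacyclic0P.
rewrite -(addsmx_diff_cap_eq (ms_mod S a) (dec_mx S a)) addsmx_sub.
apply/andP; split; last by apply: submx_trans Hdec; apply: capmxSr.
rewrite -/(new_mx S a) -(eq_row_base (new_mx S a)); apply/row_subP=> i.
pose s := @gen_mk S (BMultinom aB) i.
have -> : row i (row_base (new_mx S a)) = delta_mx 0 (enum_rank s) *m D.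
  by rewrite -rowE rowK enum_rankK.
apply: submxMr; apply/free_mxP=> k; rewrite mxE /=.
have [->|_] := eqVneq k (enum_rank s); last by rewrite eqxx.
by rewrite /lab /gen_lab enum_rankK /= lepm_refl.
Qed.

(** Generators of degree properly dividing [a] contribute decomposable elements. What remains lies
    in both [new_mx] and [dec_mx], hence is 0, and the chosen basis rows are independent. *)
Lemma gen_min a (u : 'rV_#|gen_type S|) :
  (u <= free_mx lab a)%MS -> (u *m D <= dec_mx S a)%MS ->
  forall i, lab i = a -> u 0 i = 0.
Proof.
move=> /free_mxP uF uD i0 i0a.
pose b := tag (enum_val i0); have ba : bmnm b = a by [].
pose F (c : 'X_{1..n < B}) (j : 'I_(\rank (new_mx S c))) :=
  u 0 (enum_rank (gen_mk j)) *: row j (row_base (new_mx S c)).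
pose x := \row_j u 0 (enum_rank (@gen_mk S b j)).
have E : \sum_(i | lab i == a) u 0 i *: row i D = x *m row_base (new_mx S b).
  rewrite mulmx_sum_row.
  transitivity (\sum_(s : gen_type S | tag s == b) F (tag s) (tagged s)).
    rewrite big_mkcond /= [RHS]big_mkcond /=.
    rewrite (big_enum_val (fun s : gen_type S => if tag s == b then _ else 0)).
    apply: eq_bigr => i _; rewrite /lab /gen_lab -ba -bmeqP.
    case: ifP => // _; rewrite rowK /F.
    by rewrite gen_mkK enum_valK.
  rewrite (eq_bigl (fun s : gen_type S => (tag s == b) && true)); last first.
    by move=> s; rewrite andbT.
  rewrite -(sig_big_dep (fun c => c == b) (fun _ _ => true) F) /=.
  by rewrite big_pred1_eq; apply: eq_bigr => j _; rewrite /F mxE.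
have x0 : x *m row_base (new_mx S b) = 0.
  apply/eqP; rewrite -submx0 -(capmx_diff (ms_mod S a) (dec_mx S a)) sub_capmx.
  rewrite -/(new_mx S a) -{1}ba (submx_trans (submxMl _ _)) ?eq_row_base //=.
  have := mulmx_sum_row u D; rewrite (bigID (fun i => lab i == a)) /= E => uDE.
  rewrite (canRL (addrK _) (esym uDE)) addmx_sub ?eqmx_opp //.
  apply: summx_sub => i lia; have [->|ui] := eqVneq (u 0 i) 0.
    by rewrite scale0r sub0mx.
  apply: scalemx_sub; have [j aj le] := lem_subU (uF i ui) lia.
  apply: (sumsmx_sup j) => //; apply: submx_trans (gen_row_sub i) _.
  by apply: submx_trans (new_mx_sub _) _; apply: (ms_mono SV).
have {}x0 : x = 0 by apply: (row_free_inj (row_base_free (new_mx S b))); rewrite x0 mul0mx.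
have := congr1 (fun y : 'rV_ _ => y 0 (tagged (enum_val i0))) x0.
by rewrite !mxE (gen_mkK (enum_val i0)) enum_valK.
Qed.

Lemma gen_lab_ex a : (exists i, lab i = a) <-> ~ kacyclic (ksys (ms_mod S) a) 0.
Proof.
rewrite kacyclic0P -/(dec_mx S a); split=> [[i ia]|].
  have : \rank (new_mx S a) != 0%N.
    rewrite -ia /lab /gen_lab; apply/eqP => r0.
    by have := tagged (enum_val i); rewrite r0 => -[].
  move=> r0 H; move: r0; rewrite mxrank_eq0 -submx0.
  rewrite -(capmx_diff (ms_mod S a) (dec_mx S a)) sub_capmx.
  by rewrite submx_refl /= (submx_trans (new_mx_sub _)).
move=> H; have [aB|Ba] := ltnP (mdeg a) B; last first.
  by case: H; have := ms_bound SV (p := 0) Ba; move/kacyclic0P.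
have : \rank (new_mx S a) != 0%N.
  apply: contra_notN H; rewrite mxrank_eq0 => /eqP n0.
  rewrite -(addsmx_diff_cap_eq (ms_mod S a) (dec_mx S a)) addsmx_sub.
  by rewrite -/(new_mx S a) n0 sub0mx /= capmxSr.
rewrite -lt0n => r0.
pose s := @gen_mk S (BMultinom aB) (Ordinal r0).
by exists (enum_rank s); rewrite /lab /gen_lab enum_rankK.
Qed.

Lemma ksys_gen a t v :
  ksys (ms_mod S) a t v <-> exists2 u, in_free lab a t u & v = u *m D.
Proof.
split=> [[->|[ta]]|[u uF ->]].
- by exists 0; [move=> i; rewrite mxE eqxx | rewrite mul0mx].
- rewrite gen_surj => /submxP[w ->]; exists (w *m free_mx lab (a - mset t)).
    by apply/in_freeP; right; split=> //; apply: submxMl.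
  by rewrite mulmxA.
- have /in_freeP[->|[ta ua]] := uF; first by left; rewrite mul0mx.
  by right; split=> //; rewrite gen_surj submxMr.
Qed.

Lemma ksys_syz a t u :
  ksys (syz_mod S) a t u <-> in_free lab a t u /\ u *m D = 0.
Proof.
split=> [[->|[ta]]|[uF uD]].
- by split; [move=> i; rewrite mxE eqxx | rewrite mul0mx].
- rewrite sub_capmx sub_kermx => /andP[uF /eqP uD]; split=> //.
  by apply/in_freeP; right.
- have /in_freeP[->|[ta ua]] := uF; first by left.
  by right; split=> //; rewrite sub_capmx ua sub_kermx uD eqxx.
Qed.

End Step.

Section ChainMap.

Variables (r r' : nat) (D : 'M[K]_(r, r')).

Definition kmul (c : {ffun {set 'I_n} -> 'rV[K]_r}) : {ffun {set 'I_n} -> 'rV[K]_r'} :=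
  [ffun t : {set 'I_n} => c t *m D].

Lemma kbd_kmul c : kbd (kmul c) = kmul (kbd c).
Proof.
apply/ffunP=> t; rewrite !ffunE mulmx_suml; apply: eq_bigr => k _.
by rewrite ffunE scalemxAl.
Qed.

Lemma kmulB c1 c2 : kmul (c1 - c2) = kmul c1 - kmul c2.
Proof. by apply/ffunP=> t; rewrite !ffunE mulmxBl. Qed.

End ChainMap.

(** * Koszul homology of free modules *)

Section FreeSystem.

Variables (r : nat) (lab : 'I_r -> 'X_{1..n}) (a : 'X_{1..n}).
Implicit Types c : {ffun {set 'I_n} -> 'rV[K]_r}.

Lemma kbd_coord (i : 'I_r) c (z : {ffun {set 'I_n} -> 'rV[K]_r}) t :
  (forall t, c t 0 i = z t 0 i) -> kbd c t 0 i = kbd z t 0 i.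
Proof.
move=> E; rewrite !ffunE !summxE; apply: eq_bigr => k _.
by rewrite !mxE E.
Qed.

Lemma in_freeB t u v : in_free lab a t u -> in_free lab a t v ->
  in_free lab a t (u - v).
Proof.
move=> uF vF i; rewrite !mxE; have [->|/uF//] := eqVneq (u 0 i) 0.
by rewrite sub0r oppr_eq0 => /vF.
Qed.

Lemma in_free_kbd p c : kchain (in_free lab a) p.+1 c ->
  kchain (in_free lab a) p (kbd c).
Proof.
move=> cF t; split=> [i|tp].
  rewrite ffunE summxE => s0.
  have [k kt ck] : exists2 k, k \notin t & c (k |: t) 0 i != 0.
    apply/exists_inP; apply: contraNT s0 => /exists_inPn H.
    rewrite big1 // => k kt; rewrite mxE.
    by have := H k kt; rewrite negbK => /eqP->; rewrite mulr0.
  have := (cF (k |: t)).1 i ck; apply: lepm_trans.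
  apply/mnm_lepP=> x; rewrite !mnmDE leq_add2l.
  by have /mnm_lepP := mset_mono (subsetUr [set k] t); apply.
rewrite ffunE big1 // => k kt; rewrite (cF (k |: t)).2 ?scaler0 //.
by rewrite cardsU1 kt.
Qed.

(** Coordinates do not interact. In coordinate [i] the faces are subsets of the directions where
    [lab i] is below [a], and any such direction serves as a cone point. There is none only if
    [lab i = a], where the empty face alone occurs and [p = 0]. *)
Lemma in_free_acyclic p c : kchain (in_free lab a) p c -> kbd c = 0 ->
  (p = 0%N -> forall i, lab i = a -> c set0 0 i = 0) ->
  exists2 w, kchain (in_free lab a) p.+1 w & kbd w = c.
Proof.
move=> cF bc c0.
pose pk (i : 'I_r) := [pick j | (lab i j < a j)%N].
pose w : {ffun {set 'I_n} -> 'rV[K]_r} := [ffun t : {set 'I_n} => \row_i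
  if pk i is Some j then kcone j c t 0 i else 0].
exists w.
  move=> t; split=> [i|tp].
    rewrite ffunE mxE /pk; case: pickP => [j ja|]; last by rewrite eqxx.
    rewrite ffunE; case: ifP => [jt|]; last by rewrite mxE eqxx.
    rewrite mxE => cti.
    have /(cF _).1 : c (t :\ j) 0 i != 0.
      by apply: contraNneq cti => ->; rewrite mulr0.
    move=> /mnm_lepP le; apply/mnm_lepP=> x; move: (le x).
    rewrite !mnmDE !mnmE !inE; case: eqP => [->|//]; rewrite jt /=; lia.
  apply/rowP=> i; rewrite ffunE !mxE /pk; case: pickP => // j ja.
  rewrite ffunE; case: ifP => [jt|]; last by rewrite mxE.
  rewrite (cF _).2 ?scaler0 ?mxE //; apply: contraNneq tp => <-.
  by rewrite (cardsD1 j t) jt.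
apply/ffunP=> t; apply/rowP=> i.
case E: (pk i) => [j|].
  have -> : kbd w t 0 i = kbd (kcone j c) t 0 i.
    by apply: kbd_coord => t'; rewrite ffunE mxE E.
  by rewrite kbd_kconeE bc kcone0 subr0.
have -> : kbd w t 0 i = kbd (0 : {ffun {set 'I_n} -> 'rV[K]_r}) t 0 i.
  by apply: kbd_coord => t'; rewrite !ffunE mxE E mxE.
rewrite ffunE summxE big1 => [|k _]; last by rewrite ffunE scaler0 mxE.
apply/esym/eqP; apply: contraT => cti.
have le := (cF t).1 i cti.
move: E; rewrite /pk; case: pickP => // nl _.
have t0 : t = set0.
  apply/setP=> j; rewrite in_set0; apply/negP => jt.
  by move/mnm_lepP/(_ j): le; rewrite mnmDE mnmE jt; have := nl j; lia.
have p0 : p = 0%N.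
  apply/eqP; apply: contraNT cti => p0; rewrite (cF t).2 ?mxE //.
  by rewrite t0 cards0 eq_sym.
move: cti; rewrite t0 c0 ?eqxx //; apply: lem_anti.
  by move: le; rewrite t0 mset0 addm0.
by apply/mnm_lepP=> j; have := nl j; lia.
Qed.

End FreeSystem.

(** * Dimension shift along syzygies *)

Section Shift.

Variable S : mstage.
Hypothesis SV : ms_valid S.

Let D := gen_mx S.
Let lab := @gen_lab S.

Lemma kchain_lift a p z : kchain (ksys (ms_mod S) a) p z ->
  exists2 y, kchain (in_free lab a) p y & z = kmul D y.
Proof.
move=> zM.
have H t : exists u, [/\ in_free lab a t u, z t = u *m D & #|t| != p -> u = 0].
  have [zt tp] := zM t.
  have [E|/tp z0] := eqVneq #|t| p.
    by have /(ksys_gen SV)[u uF zu] := zt; exists u; split=> //; rewrite E eqxx.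
  by exists 0; split=> //; [move=> i; rewrite mxE eqxx | rewrite z0 mul0mx].
have [f Hf] := choice H; exists [ffun t => f t].
  by move=> t; rewrite ffunE; have [] := Hf t.
by apply/ffunP=> t; rewrite !ffunE; have [] := Hf t.
Qed.

Lemma kchain_kmul a p y : kchain (in_free lab a) p y ->
  kchain (ksys (ms_mod S) a) p (kmul D y).
Proof.
move=> yF t; rewrite ffunE; split.
  by apply/(ksys_gen SV); exists (y t) => //; apply: (yF t).1.
by move=> tp; rewrite (yF t).2 ?mul0mx.
Qed.

Lemma kchain_syzP a p y : kchain (ksys (syz_mod S) a) p y <->
  kchain (in_free lab a) p y /\ kmul D y = 0.
Proof.
split=> [yN|[yF yD] t].
  split=> [t|]; last by apply/ffunP=> t; rewrite !ffunE; have [/ksys_syz[_ ->]] := yN t.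
  by have [/ksys_syz[yF _] yp] := yN t.
split; last exact: (yF t).2.
apply/ksys_syz; split; first exact: (yF t).1.
by have /ffunP/(_ t) := yD; rewrite !ffunE.
Qed.

Lemma kchain_in_freeB a p (x y : {ffun {set 'I_n} -> 'rV[K]_#|gen_type S|}) :
  kchain (in_free lab a) p x -> kchain (in_free lab a) p y ->
  kchain (in_free lab a) p (x - y).
Proof.
move=> xF yF t; rewrite chainB; split.
  by apply: in_freeB; [apply: (xF t).1 | apply: (yF t).1].
by move=> tp; rewrite (xF t).2 ?(yF t).2 ?subr0.
Qed.

Lemma syz_minimal a u i : in_free lab a set0 u -> u *m D = 0 ->
  lab i = a -> u 0 i = 0.
Proof.
move=> uF uD; apply: (gen_min SV) => //; last by rewrite -/D uD sub0mx.
by apply/free_mxP=> j /uF; rewrite mset0 addm0.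
Qed.

(** Long exact sequence of 0 -> N -> F -> M -> 0, where F is acyclic in positive degrees. For
    [p = 0], minimality (N inside (x_1,...,x_n)F) makes the map from H_0(N) to H_0(F) zero. *)
Lemma syz_shift a p :
  kacyclic (ksys (ms_mod S) a) p.+1 <-> kacyclic (ksys (syz_mod S) a) p.
Proof.
split=> acy.
  move=> x /kchain_syzP[xF xD] bx.
  have [|y yF yx] := in_free_acyclic xF bx.
    move=> p0 i; apply: syz_minimal; first exact: (xF set0).1.
    by have /ffunP/(_ set0) := xD; rewrite !ffunE.
  have [||w wM bw] := acy (kmul D y).
  - exact: kchain_kmul.
  - by rewrite kbd_kmul yx xD.
  have [u uF wu] := kchain_lift wM.
  exists (y - kbd u); last by rewrite kbdB yx kbd_kbd subr0.
  apply/kchain_syzP; split.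
    by apply: kchain_in_freeB => //; apply: in_free_kbd.
  by rewrite kmulB -kbd_kmul -wu bw subrr.
move=> z zM bz; have [y yF zy] := kchain_lift zM.
have [||m /kchain_syzP[mF mD] bm] := acy (kbd y).
- apply/kchain_syzP; split; first exact: in_free_kbd.
  by rewrite -kbd_kmul -zy.
- exact: kbd_kbd.
have [||//|w wF bw] := @in_free_acyclic _ lab a p.+1 (y - m).
- exact: kchain_in_freeB.
- by rewrite kbdB bm subrr.
exists (kmul D w); first exact: kchain_kmul.
by rewrite kbd_kmul bw kmulB mD subr0.
Qed.

Lemma ms_next_valid : ms_valid (ms_next S).
Proof.
split=> [a b ab|a|a p Ba] /=.
- rewrite /syz_mod sub_capmx capmxSr andbT.
  by apply: submx_trans (capmxSl _ _) _; apply: free_mx_mono.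
- exact: capmxSl.
- by apply/syz_shift; apply: (ms_bound SV).
Qed.

End Shift.

Definition stage (S : mstage) (i : nat) : mstage := iter i ms_next S.

Lemma stage_valid S i : ms_valid S -> ms_valid (stage S i).
Proof. by move=> SV; elim: i => //= i; apply: ms_next_valid. Qed.

Lemma stage_shift S i a p : ms_valid S ->
  kacyclic (ksys (ms_mod (stage S i)) a) p <->
  kacyclic (ksys (ms_mod S) a) (i + p).
Proof.
move=> SV; elim: i p => [|i IH] p //=.
by rewrite -syz_shift ?IH ?addnS //; apply: stage_valid.
Qed.

Lemma stage_lab_ex S i a : ms_valid S ->
  (exists k, @gen_lab (stage S i) k = a) <->
  ~ kacyclic (ksys (ms_mod S) a) i.
Proof.
move=> SV; rewrite gen_lab_ex; last exact: stage_valid.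
by rewrite stage_shift // addn0.
Qed.

End Stages.

(** * Homogeneous lifting and comparison of minimal resolutions *)

Section Homogeneous.

Variables (K : fieldType) (n : nat).
Implicit Types (f g : {mpoly K[n]}) (d e : int) (m : 'X_{1..n}).

Lemma zhomogP d f :
  zhomog d f <-> (forall m, f@_m != 0 -> (mdeg m)%:Z = d).
Proof.
case: d => d /=; split=> [H m|H].
- by rewrite -mcoeff_msupp => mf; rewrite (dhomog_mf H).
- by apply/dhomogP => m; rewrite mcoeff_msupp => /H[].
- by rewrite H mcoeff0 eqxx.
- by apply/mpolyP=> m; rewrite mcoeff0; apply/eqP; apply: contraT => /H.
Qed.

Definition zcomp d f : {mpoly K[n]} :=
  if d is Posz e then pihomog mdeg e f else 0.

Lemma mcoeff_pihomog (mf : measure n) (d : nat) f m :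
  (pihomog mf d f)@_m = if mf m == d then f@_m else 0.
Proof.
rewrite pihomogE raddf_sum /= (eq_bigr (fun k => if k == m then f@_m else 0)).
  rewrite -big_mkcondr /=; have [md|md] := eqVneq (mf m) d; last first.
    by rewrite big1 // => k /andP[/eqP kd /eqP km]; rewrite -km kd eqxx in md.
  rewrite (eq_bigl (fun k => k == m)); last first.
    by move=> k; have [->|_] := eqVneq k m; rewrite ?andbF //= md eqxx.
  have [fm|fm] := boolP (m \in msupp f).
    by rewrite -big_filter filter_pred1_uniq ?msupp_uniq // big_seq1.
  by rewrite big1 memN_msupp_eq0.
by move=> k _; rewrite mcoeffZ mcoeffX; case: eqP => [->|]; rewrite ?mulr1 ?mulr0.
Qed.

Lemma mcoeff_zcomp d f m :
  (zcomp d f)@_m = if (mdeg m)%:Z == d then f@_m else 0.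
Proof. by case: d => d /=; [rewrite mcoeff_pihomog eqz_nat | rewrite mcoeff0]. Qed.

Lemma zhomog_zcomp d f : zhomog d (zcomp d f).
Proof. by apply/zhomogP=> m; rewrite mcoeff_zcomp; case: ifP => [/eqP|]; rewrite ?eqxx. Qed.

Lemma zcomp_id d f : zhomog d f -> zcomp d f = f.
Proof.
move=> /zhomogP H; apply/mpolyP=> m; rewrite mcoeff_zcomp.
by case: eqP => // md; apply/esym/eqP; apply: contraT => /H.
Qed.

Lemma zcomp_sum (J : Type) (s : seq J) (P : pred J) (F : J -> {mpoly K[n]}) d :
  zcomp d (\sum_(j <- s | P j) F j) = \sum_(j <- s | P j) zcomp d (F j).
Proof.
apply/mpolyP=> m; rewrite mcoeff_zcomp !(raddf_sum (mcoeff m)) /=; case: ifP => md.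
  by apply: eq_bigr => j _; rewrite mcoeff_zcomp md.
by rewrite big1 // => j _; rewrite mcoeff_zcomp md.
Qed.

Lemma zcompM d e f g : zhomog e g -> zcomp d (f * g) = zcomp (d - e) f * g.
Proof.
move=> /zhomogP H; apply/mpolyP=> m; rewrite mcoeff_zcomp !mcoeffM.
case: ifP => md; last rewrite big1 //; last first.
  move=> k /eqP mk; rewrite mcoeff_zcomp.
  have [->|/H ke] := eqVneq (g@_k.2) 0; first by rewrite mulr0.
  case: eqP => [kd|]; last by rewrite mul0r.
  have := congr1 (@mdeg n) mk; rewrite mdegD => mE.
  by rewrite mE PoszD kd ke subrK eqxx in md.
apply: eq_bigr => k /eqP mk; rewrite mcoeff_zcomp.
have [->|/H ke] := eqVneq (g@_k.2) 0; first by rewrite !mulr0.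
rewrite ifT //; have := congr1 (@mdeg n) mk; rewrite mdegD => mE.
by rewrite mE PoszD ke in md; rewrite -(eqP md) addrK.
Qed.

Lemma mcoeffMX0 f m k : ~~ (m <= k)%MM -> (f * 'X_[m])@_k = 0.
Proof.
move=> mk; apply: memN_msupp_eq0; rewrite (perm_mem (msuppMX _ _)).
by apply: contra mk => /mapP[x _ ->]; apply: lem_addr.
Qed.

Lemma homog_mulmx p q r (A : 'M[{mpoly K[n]}]_(p, q)) (D : 'M_(q, r))
    (sA : 'I_p -> int) (s1 : 'I_q -> int) (s0 : 'I_r -> int) :
  (forall i j, zhomog (sA i - s1 j) (A i j)) ->
  (forall j k, zhomog (s1 j - s0 k) (D j k)) ->
  forall i k, zhomog (sA i - s0 k) ((A *m D) i k).
Proof.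
move=> Ah Dh i k; rewrite mxE.
suff <- : zcomp (sA i - s0 k) (\sum_j A i j * D j k) = \sum_j A i j * D j k.
  exact: zhomog_zcomp.
rewrite zcomp_sum; apply: eq_bigr => j _; rewrite (zcompM _ _ (Dh j k)).
by rewrite -addrA opprB addKr zcomp_id.
Qed.

(* Any lift can be replaced by its homogeneous component of the right degree. *)
Lemma homog_lift p r1 r0 (A : 'M[{mpoly K[n]}]_(p, r0)) (D : 'M_(r1, r0))
    (sA : 'I_p -> int) (s1 : 'I_r1 -> int) (s0 : 'I_r0 -> int) :
  (forall i k, zhomog (sA i - s0 k) (A i k)) ->
  (forall j k, zhomog (s1 j - s0 k) (D j k)) ->
  (forall i, exists w, row i A = w *m D) ->
  exists2 W : 'M_(p, r1), (forall i j, zhomog (sA i - s1 j) (W i j)) & A = W *m D.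
Proof.
move=> Ah Dh /choice[w wE].
exists (\matrix_(i, j) zcomp (sA i - s1 j) (w i 0 j)).
  by move=> i j; rewrite mxE; apply: zhomog_zcomp.
apply/matrixP=> i k; rewrite -(zcomp_id (Ah i k)).
have -> : A i k = (w i *m D) 0 k by rewrite -wE mxE.
rewrite !mxE zcomp_sum; apply: eq_bigr => j _; rewrite mxE (zcompM _ _ (Dh j k)).
by congr (zcomp _ _ * _); ring.
Qed.

Lemma mx_lift p r1 r0 (A : 'M[{mpoly K[n]}]_(p, r0)) (D : 'M_(r1, r0)) :
  (forall i, exists w, row i A = w *m D) -> exists W, A = W *m D.
Proof.
move=> /choice[w wE]; exists (\matrix_i w i).
by apply/row_matrixP=> i; rewrite row_mul rowK.
Qed.

End Homogeneous.

(** * Shifts do not depend on the minimal resolution *)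

Section Comparison.

Variables (K : fieldType) (n : nat) (I : set {mpoly K[n]}).

Lemma min_resolution_exact_row (F : gfree_seq K n) p i
    (A : 'M[{mpoly K[n]}]_(p, _)) : is_min_resolution F I ->
  A *m gf_diff F i = 0 -> forall k, exists w, row k A = w *m gf_diff F i.+1.
Proof.
by case=> _ _ _ ex _ AD k; apply/ex; rewrite -row_mul AD row0.
Qed.

Lemma min_resolution_dd (F : gfree_seq K n) i : is_min_resolution F I ->
  gf_diff F i.+1 *m gf_diff F i = 0.
Proof.
case=> _ _ _ ex _; apply/row_matrixP=> k; rewrite row_mul row0; apply/ex.
by exists (delta_mx 0 k); rewrite rowE.
Qed.

Lemma min_resolution_d_aug (F : gfree_seq K n) : is_min_resolution F I ->
  gf_diff F 0 *m gf_aug F = 0.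
Proof.
case=> _ _ ex _ _; apply/row_matrixP=> k; rewrite row_mul row0; apply/ex.
by exists (delta_mx 0 k); rewrite rowE.
Qed.

Lemma min_resolution_aug_row (F F' : gfree_seq K n) k :
  is_min_resolution F I -> is_min_resolution F' I ->
  exists w, row k (gf_aug F) = w *m gf_aug F'.
Proof.
move=> [_ imF _ _ _] [_ imF' _ _ _].
have : I ((row k (1%:M : 'M_(gf_rank F 0)) *m gf_aug F) 0 0).
  by rewrite imF; exists (row k 1%:M).
rewrite {1}imF' => -[w _ wE]; exists w.
apply/matrixP=> i j; rewrite !ord1 wE.
by rewrite -row_mul mul1mx.
Qed.

Lemma const_mulmx p q r (A : 'M[{mpoly K[n]}]_(p, q)) (D : 'M_(q, r)) i k :
  (forall j, (D j k)@_0%MM = 0) -> ((A *m D) i k)@_0%MM = 0.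
Proof.
move=> D0; rewrite mxE raddf_sum big1 //= => j _.
by rewrite (rmorphM (mcoeff 0%MM)) /= D0 mulr0.
Qed.

Lemma const_mulmx_l p q r (D : 'M[{mpoly K[n]}]_(p, q)) (A : 'M_(q, r)) i k :
  (forall j, (D i j)@_0%MM = 0) -> ((D *m A) i k)@_0%MM = 0.
Proof.
move=> D0; rewrite mxE raddf_sum big1 //= => j _.
by rewrite (rmorphM (mcoeff 0%MM)) /= D0 mul0r.
Qed.

Section TwoResolutions.

Variables F G : gfree_seq K n.
Hypotheses (Fres : is_min_resolution F I) (Gres : is_min_resolution G I).

(* [phi] and [psi] are comparison maps at steps [i] and [i + 1], and [h] is the
   degree [i] part of a homotopy between [phi psi] and the identity. *)
Lemma comparison i : exists (phi : 'M_(gf_rank F i, gf_rank G i))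
    (psi : 'M_(gf_rank G i, gf_rank F i))
    (phi' : 'M_(gf_rank F i.+1, gf_rank G i.+1))
    (psi' : 'M_(gf_rank G i.+1, gf_rank F i.+1))
    (h : 'M_(gf_rank F i, gf_rank F i.+1)),
  [/\ (forall a b, zhomog (gf_shift a - gf_shift b) (phi a b)) /\
      (forall a b, zhomog (gf_shift a - gf_shift b) (phi' a b)),
      phi' *m gf_diff G i = gf_diff F i *m phi,
      psi' *m gf_diff F i = gf_diff G i *m psi,
      gf_diff F i *m (phi *m psi - 1%:M - h *m gf_diff F i) = 0 &
      forall a b, ((phi *m psi - 1%:M) a b)@_0%MM = 0].
Proof.
have [[Fah Fdh] _ Fex0 Fex Fmin] := Fres.
have [[Gah Gdh] _ Gex0 Gex Gmin] := Gres.
have next j (f : 'M_(gf_rank F j.+1, gf_rank G j.+1)) (f0 : 'M_(gf_rank F j, gf_rank G j)) :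
    (forall a b, zhomog (gf_shift a - gf_shift b) (f a b)) ->
    f *m gf_diff G j = gf_diff F j *m f0 ->
    exists2 f' : 'M_(gf_rank F j.+2, gf_rank G j.+2),
      (forall a b, zhomog (gf_shift a - gf_shift b) (f' a b)) &
      f' *m gf_diff G j.+1 = gf_diff F j.+1 *m f.
  move=> fh fE.
  have [||a|W Wh WE] := @homog_lift _ _ _ _ _ (gf_diff F j.+1 *m f) (gf_diff G j.+1)
      (@gf_shift _ _ F j.+2) (@gf_shift _ _ G j.+2) (@gf_shift _ _ G j.+1).
  - exact: homog_mulmx (Fdh _) fh.
  - exact: Gdh.
  - apply: (min_resolution_exact_row Gres).
    by rewrite -mulmxA fE mulmxA (min_resolution_dd _ Fres) mul0mx.
  by exists W.
elim: i => [|i [phi [psi [phi' [psi' [h [[ph ph'] pE qE hE c0]]]]]]].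
  have [||a|phi phih phiE] := @homog_lift _ _ _ _ _ (gf_aug F) (gf_aug G)
      (@gf_shift _ _ F 0) (@gf_shift _ _ G 0) (fun _ => 0).
  - by move=> a b; rewrite subr0 ord1.
  - by move=> a b; rewrite subr0 ord1.
  - exact: min_resolution_aug_row.
  (* [psi] needs no homogeneity: shifts are read off from [phi] alone. *)
  have [a|psi psiE] := @mx_lift _ _ _ _ _ (gf_aug G) (gf_aug F).
    exact: min_resolution_aug_row.
  have [||a|phi' phih' phiE'] := @homog_lift _ _ _ _ _ (gf_diff F 0 *m phi) (gf_diff G 0)
      (@gf_shift _ _ F 1) (@gf_shift _ _ G 1) (@gf_shift _ _ G 0).
  - exact: homog_mulmx (Fdh _) phih.
  - exact: Gdh.
  - apply/Gex0; rewrite -row_mul -mulmxA -phiE (min_resolution_d_aug Fres).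
    exact: row0.
  have [a|psi' psiE'] := @mx_lift _ _ _ _ _ (gf_diff G 0 *m psi) (gf_diff F 0).
    apply/Fex0; rewrite -row_mul -mulmxA -psiE (min_resolution_d_aug Gres).
    exact: row0.
  have [a|h hE] := @mx_lift _ _ _ _ _ (phi *m psi - 1%:M) (gf_diff F 0).
    apply/Fex0; rewrite -row_mul mulmxBl -mulmxA -psiE -phiE mul1mx subrr.
    exact: row0.
  exists phi, psi, phi', psi', h; split=> //.
    by rewrite hE subrr mulmx0.
  by move=> a b; rewrite hE; apply: const_mulmx => j; apply: Fmin.
have [phi'' ph'' pE'] := next _ _ _ ph' pE.
have [a|psi'' qE'] := @mx_lift _ _ _ _ _ (gf_diff G i.+1 *m psi') (gf_diff F i.+1).
  apply: (min_resolution_exact_row Fres).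
  by rewrite -mulmxA qE mulmxA (min_resolution_dd _ Gres) mul0mx.
have [a|h' hE'] := @mx_lift _ _ _ _ _
    (phi' *m psi' - 1%:M - gf_diff F i *m h) (gf_diff F i.+1).
  apply: (min_resolution_exact_row Fres).
  rewrite !mulmxBl -mulmxA qE mulmxA pE mul1mx -!mulmxA -[X in _ - X - _]mulmx1.
  by rewrite -!mulmxBr.
exists phi', psi', phi'', psi'', h'; split=> //.
  rewrite -hE' subKr mulmxA (min_resolution_dd _ Fres); exact: mul0mx.
(* [phi' psi' - 1] is a sum of two products, each with a differential as a factor; by minimality
   both have entries without constant term. *)
move=> a b; rewrite -(subrK (gf_diff F i *m h) (phi' *m psi' - 1%:M)) hE'.
by rewrite mxE mcoeffD const_mulmx ?const_mulmx_l ?addr0.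
Qed.

(** Modulo the variables [phi psi] is the identity, so row [a] of [phi] has an entry with nonzero
    constant term, which homogeneity puts in degree 0. Multiplicities are left aside, as [reg]
    depends only on which Betti numbers are nonzero. *)
Lemma min_resolution_shift i (a : 'I_(gf_rank F i)) :
  exists b : 'I_(gf_rank G i), gf_shift b = gf_shift a.
Proof.
have [phi [psi [_ [_ [_ [[ph _] _ _ _ c0]]]]]] := comparison i.
have : ((phi *m psi) a a)@_0%MM != 0.
  move: (c0 a a); rewrite !mxE mcoeffB eqxx mcoeff1 eqxx => /eqP.
  by rewrite subr_eq0 => /eqP->; apply: oner_neq0.
rewrite mxE raddf_sum /= => s0.
have [b ab] : exists b, (phi a b * psi b a)@_0%MM != 0.
  apply/existsP; apply: contraNT s0; rewrite negb_exists => /forallP H.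
  by rewrite big1 // => b _; have := H b; rewrite negbK => /eqP.
exists b; have := (zhomogP _ _).1 (ph a b) 0%MM.
move: ab; rewrite (rmorphM (mcoeff 0%MM)) mulf_eq0 negb_or => /andP[pab _] /(_ pab).
by rewrite mdeg0; lia.
Qed.

End TwoResolutions.

Lemma betti_neq0P (F : gfree_seq K n) i j : is_min_resolution F I ->
  betti I i j <> 0%N <-> exists a : 'I_(gf_rank F i), gf_shift a = j.
Proof.
move=> Fres; rewrite /betti.
set A := (X in xget _ X).
have : A (xget 0%N A).
  apply: xgetPex; exists #|[set a : 'I_(gf_rank F i) | gf_shift a == j]%SET|.
  by exists F.
case=> G Gres ->; split.
  move/eqP; rewrite -lt0n => /card_gt0P[a]; rewrite inE => /eqP aj.
  by have [b bE] := min_resolution_shift Gres Fres a; exists b; rewrite bE.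
case=> a aj; apply/eqP; rewrite -lt0n; apply/card_gt0P.
have [b bE] := min_resolution_shift Fres Gres a.
by exists b; rewrite inE bE aj.
Qed.

End Comparison.

(** * Regularity of a monomial ideal *)

Section Homogenization.

Variables (K : fieldType) (n : nat).
Implicit Types (a : 'X_{1..n}).

Definition hcomp r (lab : 'I_r -> 'X_{1..n}) a (v : 'rV[{mpoly K[n]}]_r) : 'rV[K]_r :=
  \row_i if (lab i <= a)%MM then (v 0 i)@_(a - lab i)%MM else 0.

(** The truncated subtraction of exponents is exact wherever [D i k] is nonzero, by the hypothesis
    [labD] below. *)
Definition polymx r r' (lab : 'I_r -> 'X_{1..n}) (lab' : 'I_r' -> 'X_{1..n})
    (D : 'M[K]_(r, r')) : 'M[{mpoly K[n]}]_(r, r') :=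
  \matrix_(i, k) (D i k *: 'X_[lab i - lab' k]).

Lemma hcomp_free r (lab : 'I_r -> 'X_{1..n}) a v :
  (hcomp lab a v <= free_mx K lab a)%MS.
Proof. by apply/free_mxP=> i; rewrite mxE; case: ifP; rewrite ?eqxx. Qed.

Lemma hcompB r (lab : 'I_r -> 'X_{1..n}) a v w :
  hcomp lab a (v - w) = hcomp lab a v - hcomp lab a w.
Proof.
by apply/rowP=> i; rewrite !mxE; case: ifP; rewrite ?mcoeffB ?subr0.
Qed.

Lemma hcomp0 r (lab : 'I_r -> 'X_{1..n}) a : hcomp lab a 0 = 0.
Proof. by apply/rowP=> i; rewrite !mxE mcoeff0 if_same. Qed.

Lemma hcomp_eq0 r (lab : 'I_r -> 'X_{1..n}) v :
  (forall a, hcomp lab a v = 0) -> v = 0.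
Proof.
move=> v0; apply/rowP=> i; rewrite mxE; apply/mpolyP=> m; rewrite mcoeff0.
have /rowP/(_ i) := v0 (m + lab i)%MM.
by rewrite !mxE lem_addl addmK.
Qed.

Lemma hcomp_bounded r (lab : 'I_r -> 'X_{1..n}) v :
  exists C, forall a, (C <= mdeg a)%N -> hcomp lab a v = 0.
Proof.
exists (\sum_i (msize (v 0%R i) + mdeg (lab i)))%N => a Ca.
apply/rowP=> i; rewrite !mxE; case: ifP => // la.
apply/memN_msupp_eq0/msize_mdeg_ge.
have := congr1 (@mdeg n) (submK la); rewrite mdegD.
by move: Ca; rewrite (bigD1 i) //=; lia.
Qed.

Section Polymx.

Variables (r r' : nat) (lab : 'I_r -> 'X_{1..n}) (lab' : 'I_r' -> 'X_{1..n}).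
Variable D : 'M[K]_(r, r').
Hypothesis labD : forall i k, D i k != 0 -> (lab' k <= lab i)%MM.

Lemma hcomp_polymx a v :
  hcomp lab' a (v *m polymx lab lab' D) = hcomp lab a v *m D.
Proof.
apply/rowP=> k; rewrite !mxE; case: ifPn => ka; last first.
  rewrite big1 // => i _; rewrite mxE.
  have [->|/labD ki] := eqVneq (D i k) 0; first by rewrite mulr0.
  case: ifP => [ia|]; last by rewrite mul0r.
  by case/negP: ka; apply: lepm_trans ia.
rewrite raddf_sum; apply: eq_bigr => i _; rewrite !mxE -scalerAr /= mcoeffZ.
have [->|/labD ki] := eqVneq (D i k) 0; first by rewrite mul0r mulr0.
case: ifPn => ia.
  have -> : (a - lab' k = (lab i - lab' k) + (a - lab i))%MM.
    apply/mnmP=> x; rewrite mnmDE !mnmBE.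
    by move/mnm_lepP/(_ x): ia; move/mnm_lepP/(_ x): ki; lia.
  by rewrite mcoeffMX mulrC.
rewrite mcoeffMX0 ?mulr0 ?mul0r //; apply: contra ia.
by rewrite lem_add_sub // submK.
Qed.

(** Each multidegree is lifted on its own over K; only finitely many components of [v] are nonzero,
    so the lifts add up to a polynomial row. *)
Lemma hcomp_lift v : (forall a, (hcomp lab' a v <= free_mx K lab a *m D)%MS) ->
  exists w, v = w *m polymx lab lab' D.
Proof.
move=> vD; have H a : exists u, (u <= free_mx K lab a)%MS /\ hcomp lab' a v = u *m D.
  have /submxP[w wE] := vD a; exists (w *m free_mx K lab a).
  by rewrite submxMl wE mulmxA.
have [u uP] := choice H; have [C vC] := hcomp_bounded lab' v.
pose w : 'rV[{mpoly K[n]}]_r :=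
  \row_i \sum_(b : 'X_{1..n < C}) u b 0 i *: 'X_[b - lab i].
have wE a : (mdeg a < C)%N -> hcomp lab a w = u a.
  move=> aC; apply/rowP=> i; rewrite !mxE.
  have uF (b : 'X_{1..n}) : u b 0 i != 0 -> (lab i <= b)%MM.
    by move=> ui; have [/free_mxP/(_ i ui)] := uP b.
  case: ifPn => ia; last by apply/esym/eqP; apply: contraNT ia => /uF.
  rewrite raddf_sum (bigD1 (BMultinom aC)) //= big1 ?addr0 => [|b ba].
    by rewrite mcoeffZ mcoeffX eqxx mulr1.
  rewrite mcoeffZ mcoeffX; have [->|/uF ib] := eqVneq (u b 0 i) 0.
    by rewrite mul0r.
  case: eqP => [E|]; last by rewrite mulr0.
  move: ba; rewrite bmeqP /= -(submK ib) E submK ?eqxx //.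
exists w; apply/eqP; rewrite -subr_eq0; apply/eqP.
apply: (@hcomp_eq0 _ lab') => a; rewrite hcompB hcomp_polymx.
have [aC|Ca] := ltnP (mdeg a) C.
  by rewrite wE // (uP a).2 subrr.
rewrite vC // sub0r (_ : hcomp lab a w = 0) ?mul0mx ?oppr0 //.
apply/rowP=> i; rewrite !mxE; case: ifP => // ia.
rewrite raddf_sum big1 // => b _ /=; rewrite mcoeffZ mcoeffX.
have [->|ui] := eqVneq (u b 0 i) 0; first by rewrite mul0r.
have [/free_mxP/(_ i ui) ib _] := uP b.
case: eqP => [E|]; last by rewrite mulr0.
have : mdeg b = mdeg a by rewrite -(submK ib) E submK.
by move: (bmdeg b) Ca; lia.
Qed.

End Polymx.

End Homogenization.

(** * The minimal resolution and the regularity of a monomial ideal *)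

Section StageResolution.

Variables (K : fieldType) (n B : nat).
Implicit Types (S : mstage K n) (a : 'X_{1..n}).

Definition gen_polymx S : 'M[{mpoly K[n]}]_(#|gen_type B S|, ms_rank S) :=
  polymx (@gen_lab _ _ B S) (@ms_lab _ _ S) (gen_mx B S).

Lemma gen_mx_lab S : ms_valid B S -> forall i k, gen_mx B S i k != 0 ->
  (ms_lab k <= gen_lab i)%MM.
Proof.
move=> SV i k Dik.
have /free_mxP := submx_trans (submx_trans (gen_row_sub (B := B) i) (new_mx_sub S _)) (ms_sub SV _).
by apply; rewrite mxE.
Qed.

Lemma gen_polymx_im S v : ms_valid B S ->
  (forall a, (hcomp (@ms_lab _ _ S) a v <= ms_mod S a)%MS) <->
  exists w, v = w *m gen_polymx S.
Proof.
move=> SV; split=> [H|[w ->] a].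
  by apply: hcomp_lift; [exact: gen_mx_lab | move=> a; rewrite -(gen_surj SV)].
by rewrite hcomp_polymx ?(gen_surj SV) ?submxMr ?hcomp_free //; apply: gen_mx_lab.
Qed.

Lemma gen_polymx_ker S v : ms_valid B S ->
  v *m gen_polymx S = 0 <->
  (forall a, (hcomp (@gen_lab _ _ B S) a v <= syz_mod B S a)%MS).
Proof.
move=> SV; have labD := gen_mx_lab SV; split=> [v0 a|H].
  rewrite sub_capmx hcomp_free sub_kermx -(hcomp_polymx labD).
  by rewrite -/(gen_polymx S) v0 hcomp0 eqxx.
apply: (hcomp_eq0 (lab := @ms_lab _ _ S)) => a; rewrite hcomp_polymx //.
by move: (H a); rewrite sub_capmx sub_kermx => /andP[_ /eqP].
Qed.

Lemma gen_polymx_homog S i k : ms_valid B S ->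
  zhomog ((mdeg (gen_lab i))%:Z - (mdeg (ms_lab k))%:Z) (gen_polymx S i k).
Proof.
move=> SV; rewrite mxE; apply/zhomogP=> m; rewrite mcoeffZ mcoeffX mulf_eq0 negb_or.
case/andP=> /(gen_mx_lab SV) ki.
have [<- _|_] := eqVneq (gen_lab i - ms_lab k)%MM m; last by rewrite eqxx.
have := congr1 (@mdeg n) (submK ki); rewrite mdegD; lia.
Qed.

(** A nonzero constant entry would join two generators of equal degree; but row [i] is a syzygy of
    minimal generators, and [gen_min] forbids such a coefficient. *)
Lemma gen_polymx_minimal S i k : ms_valid B S ->
  (gen_polymx (ms_next B S) i k)@_0%MM = 0.
Proof.
move=> SV; have NV := ms_next_valid SV.
rewrite mxE mcoeffZ mcoeffX; case: eqP => [E|]; last by rewrite mulr0.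
have [->|Dik] := eqVneq (gen_mx B (ms_next B S) i k) 0; first by rewrite mul0r.
have ki := gen_mx_lab NV Dik.
have lk : ms_lab k = gen_lab i by rewrite -[LHS]add0m -E submK.
have rD := submx_trans (gen_row_sub (B := B) i) (new_mx_sub (ms_next B S) _).
have := rD; rewrite sub_capmx sub_kermx => /andP[rF /eqP rK].
have := gen_min SV rF; rewrite rK sub0mx => /(_ isT k lk).
by rewrite mxE => /eqP; rewrite (negbTE Dik).
Qed.

Definition stage_resolution S (A : 'cV[{mpoly K[n]}]_#|gen_type B S|) : gfree_seq K n :=
  @GFreeSeq K n (fun i => #|gen_type B (stage B S i)|)
    (fun i k => (mdeg (gen_lab k))%:Z) A
    (fun i => gen_polymx (stage B S i.+1)).

Variable J : pred 'X_{1..n}.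
Hypothesis Jup : forall a b, (a <= b)%MM -> J a -> J b.

Definition ideal_stage : mstage K n :=
  @MStage K n 1 (fun _ => 0%MM) (fun a => (J a)%:R%:M).

Definition mon_ideal : set {mpoly K[n]} :=
  fun f => forall a, f@_a != 0 -> J a.

Hypothesis Jbound : forall a p, (B <= mdeg a)%N ->
  kacyclic (ksys (ms_mod ideal_stage) a) p.

Lemma ideal_stage_valid : ms_valid B ideal_stage.
Proof.
split=> // [a b ab|a] /=.
  by case Ja: (J a); rewrite ?(Jup ab Ja) //; rewrite raddf0 sub0mx.
by apply/rV_subP=> v _; apply/free_mxP=> i _; apply/mnm_lepP=> j; rewrite mnm0E.
Qed.

Lemma mon_idealP (v : 'rV[{mpoly K[n]}]_1) :
  mon_ideal (v 0 0) <->
  (forall a, (hcomp (@ms_lab _ _ ideal_stage) a v <= ms_mod ideal_stage a)%MS).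
Proof.
have E a : hcomp (@ms_lab _ _ ideal_stage) a v = ((v 0 0)@_a)%:M.
  apply/rowP=> i; rewrite !mxE !ord1 eqxx mulr1n subm0 ifT //.
  by apply/mnm_lepP=> j; rewrite mnm0E.
split=> H a; last move=> va; move: (H a); rewrite E /=.
  case: (J a) => [_|]; first by rewrite submx1.
  by have [->|_ /(_ isT)//] := eqVneq ((v 0 0)@_a) 0; rewrite raddf0 sub0mx.
case: (J a) => //; rewrite raddf0 submx0 => /eqP/matrixP/(_ 0 0).
by rewrite !mxE eqxx => /eqP; rewrite (negbTE va).
Qed.

Definition ideal_resolution := @stage_resolution ideal_stage (gen_polymx ideal_stage).

Lemma ideal_resolution_min : is_min_resolution ideal_resolution mon_ideal.
Proof.
have V := ideal_stage_valid; have SV i := stage_valid i V.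
split.
- split=> [a|i a b]; last exact: gen_polymx_homog.
  have := @gen_polymx_homog ideal_stage a 0 V; rewrite mdeg0 subr0; exact.
- apply/funext=> f; apply/propext; split=> [fJ|[w _ <-]].
    have [|w wE] := (@gen_polymx_im ideal_stage f%:M V).1.
      by apply/mon_idealP; rewrite mxE eqxx.
    by exists w => //=; rewrite -wE mxE eqxx.
  by apply/mon_idealP/gen_polymx_im => //; exists w.
- move=> v /=; rewrite (gen_polymx_ker _ V).
  exact: (@gen_polymx_im (stage B ideal_stage 1) v (SV 1%N)).
- move=> i v /=; rewrite (gen_polymx_ker _ (SV i.+1)).
  exact: (@gen_polymx_im (stage B ideal_stage i.+2) v (SV i.+2)).
- by move=> i a b; apply: gen_polymx_minimal.
Qed.

Lemma betti_mon_ideal i (j : int) : betti mon_ideal i j <> 0%N <->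
  exists2 a, (mdeg a)%:Z = j & ~ kacyclic (ksys (ms_mod ideal_stage) a) i.
Proof.
rewrite (betti_neq0P i j ideal_resolution_min); split=> [[k kj]|[a aj na]].
  exists (gen_lab k) => //; apply/(stage_lab_ex i _ ideal_stage_valid).
  by exists k.
have /(stage_lab_ex i _ ideal_stage_valid)[k ka] := na.
by exists k; rewrite -aj -ka.
Qed.

Lemma reg_mon_ideal a0 i0 : ~ kacyclic (ksys (ms_mod ideal_stage) a0) i0 ->
  (forall a i, ~ kacyclic (ksys (ms_mod ideal_stage) a) i ->
     (mdeg a)%:Z - i%:Z <= reg mon_ideal) /\
  exists a i, ~ kacyclic (ksys (ms_mod ideal_stage) a) i /\
     reg mon_ideal = (mdeg a)%:Z - i%:Z.
Proof.
move=> nv0; rewrite /reg; set A := (X in is_max X).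
have AP x : A x <-> exists a i,
    ~ kacyclic (ksys (ms_mod ideal_stage) a) i /\ x = (mdeg a)%:Z - i%:Z.
  split=> [[i [j [/betti_mon_ideal[a aj na] ->]]]|[a [i [na ->]]]].
    by exists a, i; rewrite aj.
  by exists i, (mdeg a)%:Z; split=> //; apply/betti_mon_ideal; exists a.
have Abound x : A x -> x <= B%:Z.
  move=> /AP[a [i [na ->]]]; have [aB|/Jbound-/(_ i)//] := ltnP (mdeg a) B.
  by lia.
(* The maximum is found as [B - k] for the least natural [k] with [B - k] in [A]. *)
have Aex : exists k : nat, `[< A (B%:Z - k%:Z) >].
  have A0 : A ((mdeg a0)%:Z - i0%:Z) by apply/AP; exists a0, i0.
  have := Abound _ A0; move: A0; set x := _ - _ => A0 xB.
  exists `|B%:Z - x|%N; apply/asboolP; rewrite gez0_abs ?subr_ge0 //.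
  by rewrite subKr.
have Amax : is_max A (xget 0 (is_max A)).
  apply: xgetPex; case: (ex_minnP Aex) => k /asboolP Ak kmin.
  exists (B%:Z - k%:Z); split=> // x Ax; have xB := Abound _ Ax.
  have := kmin `|B%:Z - x|%N; rewrite gez0_abs ?subr_ge0 // subKr.
  by move=> /(_ (asboolT Ax)); lia.
have [Ar ub] := Amax; split; last exact/AP.
by move=> a i na; apply: ub; apply/AP; exists a, i.
Qed.

End StageResolution.

(** * Symbolic powers of squarefree monomial ideals *)

Section IdealGen.

Variables (R : comNzRingType).
Implicit Types (A X : set R).

Lemma ideal_gen_ideal A : is_ideal (ideal_gen A).
Proof.
split=> [X [[X0 _ _] _] //|f g Af Ag X AX|f g Ag X AX].
  by have [[_ XD _] _] := AX; apply: XD; [apply: Af | apply: Ag].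
by have [[_ _ XM] _] := AX; apply: XM; apply: Ag.
Qed.

Lemma ideal_gen_in A f : A f -> ideal_gen A f.
Proof. by move=> Af X [_]; apply. Qed.

Lemma ideal_gen_sub A X : is_ideal X -> (forall f, A f -> X f) ->
  forall f, ideal_gen A f -> X f.
Proof. by move=> Xid AX f; apply. Qed.

Lemma is_ideal_sum X (J : Type) (r : seq J) (P : pred J) (F : J -> R) :
  is_ideal X -> (forall j, P j -> X (F j)) -> X (\sum_(j <- r | P j) F j).
Proof. by case=> X0 XD _ XF; elim/big_ind: _. Qed.

Lemma ideal_powS A m f g : A f -> ideal_pow A m g -> ideal_pow A m.+1 (f * g).
Proof.
move=> Af; have [P0 PD PM] := ideal_gen_ideal
  [set f | exists2 u : 'I_m.+1 -> R, forall i, A (u i) & f = \prod_(i < m.+1) u i]%classic.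
apply: (ideal_gen_sub (X := [set g | ideal_pow A m.+1 (f * g)]%classic)).
  split=> [|x y /= xp yp|x y /= yp]; first by rewrite /= mulr0.
    by rewrite mulrDr; apply: PD.
  by rewrite mulrCA; apply: PM.
move=> _ [u uA ->]; apply: ideal_gen_in.
exists (fun i => oapp u f (unlift ord0 i)).
  by move=> i; case: unliftP => [j _|_] //=.
rewrite big_ord_recl unlift_none; congr (_ * _).
by apply: eq_bigr => i _; rewrite liftK.
Qed.

Lemma ideal_pow0 A f : ideal_pow A 0 f.
Proof.
have [_ _ PM] := ideal_gen_ideal
  [set f | exists2 u : 'I_0 -> R, forall i, A (u i) & f = \prod_(i < 0) u i]%classic.
rewrite -[f]mulr1; apply: PM; apply: ideal_gen_in.
by exists (fun _ => 0); [case | rewrite big_ord0].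
Qed.

Lemma prime_idealP (p : set R) : is_prime_ideal p <->
  [/\ is_ideal p, ~ p 1 & forall f g, p (f * g) -> p f \/ p g].
Proof.
split=> [[[p0 p1 pD] pp]|[[p0 pD pM] p1 pp]].
  have E f : (f \in [pred f in p]) = (f \in p) by [].
  rewrite !E in p0 p1; move/set_mem in p0.
  have p1' : ~ p 1 by move=> p1'; move: p1; rewrite mem_set.
  have pD' a u v : p u -> p v -> p (a * u + v).
    move=> pu pv; apply: set_mem; rewrite -E.
    by apply: pD; rewrite E; apply: mem_set.
  split=> // [|f g].
    split=> // f g pf; first by move=> pg; rewrite -[f]mul1r; apply: pD'.
    by rewrite -[f * g]addr0; apply: pD'.
  have := pp f g; rewrite !E => H /mem_set/H/orP[]/set_mem; by [left|right].
split; first split.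
- exact: mem_set.
- by apply/negP => /set_mem.
- by move=> a u v /set_mem pu /set_mem pv; apply: mem_set; apply: pD => //; apply: pM.
- by move=> u v /set_mem/pp[pu|pv]; apply/orP; [left|right]; apply: mem_set.
Qed.

End IdealGen.

(** * Powers of primes generated by variables *)

Section WeightIdeals.

Variables (K : fieldType) (n : nat).
Implicit Types (P : {set 'I_n}) (u : 'X_{1..n}) (f g : {mpoly K[n]}).

Definition wdeg P u : nat := \sum_(i in P) u i.

Lemma wdeg0 P : wdeg P 0%MM = 0%N.
Proof. by rewrite /wdeg big1 // => i _; rewrite mnm0E. Qed.

Lemma wdegD P : {morph wdeg P : u v / (u + v)%MM >-> (u + v)%N}.
Proof. by move=> u v; rewrite /wdeg -big_split; apply: eq_bigr => i _; rewrite mnmDE. Qed.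

(** Being a measure gives access to the components [pihomog (wdeg P)] of fixed weight. *)
HB.instance Definition _ P := isMeasure.Build n (wdeg P) (wdeg0 P) (wdegD P).

Lemma wdeg_gt0 P u : (0 < wdeg P u)%N -> exists2 i, i \in P & (0 < u i)%N.
Proof.
move=> uP; apply/exists_inP; apply: contraTT uP => /exists_inPn H.
by rewrite -eqn0Ngt /wdeg big1 // => i /H; case: (u i).
Qed.

Lemma wdeg_ge P u i : i \in P -> (u i <= wdeg P u)%N.
Proof. by move=> iP; rewrite /wdeg (bigD1 i) //= leq_addr. Qed.

(* The [m]-th power of the prime generated by the variables in [P]. *)
Definition wideal P (m : nat) : set {mpoly K[n]} :=
  fun f => forall u, f@_u != 0 -> (m <= wdeg P u)%N.

Lemma widealM P a b f g : wideal P a f -> wideal P b g -> wideal P (a + b) (f * g).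
Proof.
move=> fa gb u; rewrite mcoeffM => s0.
have [k /andP[/eqP uk c0]] : exists k : 'X_{1..n < (mdeg u).+1, (mdeg u).+1},
    (u == (k.1 + k.2)%MM) && (f@_k.1 * g@_k.2 != 0).
  apply/existsP; apply: contraNT s0; rewrite negb_exists => /forallP H.
  by rewrite big1 // => k uk; have := H k; rewrite uk /= negbK => /eqP.
move: c0; rewrite mulf_eq0 negb_or => /andP[/fa ha /gb hb].
by rewrite uk wdegD leq_add.
Qed.

Lemma wideal_ideal P m : is_ideal (wideal P m).
Proof.
split=> [u|f g fm gm u|f g gm]; first by rewrite mcoeff0 eqxx.
  by rewrite mcoeffD; have [->|/fm//] := eqVneq (f@_u) 0; rewrite add0r => /gm.
by rewrite -[m]add0n; apply: widealM.
Qed.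

Lemma widealX P m u : wideal P m 'X_[u] <-> (m <= wdeg P u)%N.
Proof.
split=> [/(_ u)|H v]; first by rewrite mcoeffX eqxx oner_eq0; apply.
by rewrite mcoeffX; have [<-//|_] := eqVneq u v; rewrite eqxx.
Qed.

(* Powers of a prime generated by variables are primary: compare the components
   of lowest weight. *)
Lemma wideal_primary P m s f : ~ wideal P 1 s -> wideal P m (s * f) -> wideal P m f.
Proof.
move=> s1 sf; apply: contrapT => fm.
have [u1 us w1] : exists2 u, s@_u != 0 & wdeg P u = 0%N.
  apply: contrapT => H; apply: s1 => u us; rewrite lt0n; apply/eqP => w0.
  by apply: H; exists u.
have [u2 /andP[uf wm] umin] : exists2 u, (f@_u != 0) && (wdeg P u < m)%N &
    forall v, f@_v != 0 -> (wdeg P u <= wdeg P v)%N.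
  have ex : exists d, `[< exists2 u, f@_u != 0 & wdeg P u = d >].
    apply: contrapT => H; apply: fm => u uf; case: H.
    by exists (wdeg P u); apply/asboolP; exists u.
  case: (ex_minnP ex) => d /asboolP[u uf ud] dmin; exists u.
    rewrite uf /= ltnNge; apply/negP => mu; apply: fm => v vf.
    apply: leq_trans mu _; rewrite ud; apply: dmin; apply/asboolP.
    by exists v.
  by move=> v vf; rewrite ud; apply: dmin; apply/asboolP; exists v.
pose d := wdeg P u2.
have p0 : pihomog (wdeg P) 0 s * pihomog (wdeg P) d f != 0.
  rewrite mulf_eq0 negb_or; apply/andP; split.
    apply: contraNneq us => /(congr1 (mcoeff u1)).
    by rewrite mcoeff_pihomog /= w1 eqxx mcoeff0 => /eqP.
  by apply: contraNneq uf => /(congr1 (mcoeff u2)); rewrite mcoeff_pihomog /= eqxx mcoeff0 => /eqP.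
have [v v0] : exists v, (pihomog (wdeg P) 0 s * pihomog (wdeg P) d f)@_v != 0.
  apply: contrapT => H; case/eqP: p0; apply/mpolyP => v; rewrite mcoeff0.
  by apply/eqP; apply: contraT => v0; case: H; exists v.
have vd : wdeg P v = d.
  apply: (@dhomog_mf _ _ (wdeg P) _ (pihomog (wdeg P) 0 s * pihomog (wdeg P) d f)).
    by rewrite -[d]add0n; apply: dhomogM; apply: pihomogP.
  by rewrite mcoeff_msupp.
have : (s * f)@_v != 0.
  rewrite (_ : _@_v = (pihomog (wdeg P) 0 s * pihomog (wdeg P) d f)@_v) //.
  rewrite !mcoeffM; apply: eq_bigr => k /eqP kv; rewrite !mcoeff_pihomog /=.
  have wE : d = (wdeg P k.1 + wdeg P k.2)%N by rewrite -vd -wdegD -kv.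
  have [k2|k2] := eqVneq (wdeg P k.2) d.
    by rewrite (_ : wdeg P k.1 = 0)%N //; lia.
  have [->|/umin] := eqVneq (f@_k.2) 0; first by rewrite !mulr0.
  by rewrite -/d; lia.
by move/sf; rewrite vd leqNgt wm.
Qed.

Lemma wideal_prime P : is_prime_ideal (wideal P 1).
Proof.
apply/prime_idealP; split; first exact: wideal_ideal.
  by move=> /(_ 0%MM); rewrite mcoeff1 eqxx oner_eq0 wdeg0 => /(_ isT).
move=> f g fg; have [?|nf] := pselect (wideal P 1 f); first by left.
by right; apply: wideal_primary fg.
Qed.

Lemma prime_ideal_monomial (p : set {mpoly K[n]}) u : is_prime_ideal p ->
  p 'X_[u] -> exists2 i, (0 < u i)%N & p 'X_i.
Proof.
move=> /prime_idealP[pid p1 pp].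
have [N] := ubnP (mdeg u); elim: N u => // N IH u uN pu.
have [u0|u0] := eqVneq u 0%MM; first by move: pu; rewrite u0 mpolyX0.
have [i ui _] : exists2 i, (0 < u i)%N & (0 <= u - U_(i))%MM.
  by apply: lem_subU; [apply/mnm_lepP => i; rewrite mnm0E | rewrite eq_sym].
have iu : (U_(i) <= u)%MM by rewrite lep1mP -lt0n.
move: pu; rewrite -(submK iu) mpolyXD => /pp[/IH[]|pi].
- by have := mdeg_subU ui; lia.
- by move=> k ku pk; exists k => //; move: ku; rewrite mnmDE mnmBE; lia.
- by exists i => //; rewrite mnmDE mnm1E eqxx addn1.
Qed.

Lemma wideal_sub (p : set {mpoly K[n]}) P : is_ideal p ->
  (forall i, i \in P -> p 'X_i) -> forall f, wideal P 1 f -> p f.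
Proof.
move=> pid Pp f fP; rewrite (mpolyE f) big_seq_cond.
apply: is_ideal_sum => // u; rewrite andbT mcoeff_msupp => /fP/wdeg_gt0[i /Pp pi ui].
have iu : (U_(i) <= u)%MM by rewrite lep1mP -lt0n.
have [_ _ pM] := pid.
by rewrite -mul_mpolyC -(submK iu) mpolyXD mulrA; apply: pM.
Qed.

End WeightIdeals.

(** * Symbolic powers as intersections of powers of monomial primes *)

Section SquarefreeIdeals.

Variables (K : fieldType) (n : nat) (I : set {mpoly K[n]}) (A : set 'X_{1..n}).
Hypotheses (Asqf : forall a, A a -> squarefree_mnm a)
  (IE : I = ideal_gen [set f | exists2 a, A a & f = 'X_[a]]%classic).
Hypotheses (I0 : I <> [set 0]%classic) (I1 : I <> [set: {mpoly K[n]}]%classic).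
Implicit Types P : {set 'I_n}.

Lemma gen_mem a : A a -> I 'X_[a].
Proof. by move=> Aa; rewrite IE; apply: ideal_gen_in; exists a. Qed.

Lemma cover_wideal P : (forall a, A a -> (0 < wdeg P a)%N) <->
  (I `<=` wideal P 1)%classic.
Proof.
split=> [AP f|IP a Aa]; last by have /IP/widealX := gen_mem Aa.
rewrite IE; apply: ideal_gen_sub; first exact: wideal_ideal.
by move=> _ [a /AP aP ->]; apply/widealX.
Qed.

Lemma gen_neq0 a : A a -> a != 0%MM.
Proof.
move=> Aa; apply/eqP => a0; apply: I1; apply/seteqP; split=> // f _.
have := gen_mem Aa; rewrite a0 mpolyX0 IE => i1.
have [_ _ IM] := ideal_gen_ideal [set f | exists2 a, A a & f = 'X_[a] :> {mpoly K[n]}]%classic.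
by rewrite -[f]mulr1; apply: IM.
Qed.

Lemma gen_ex : exists a, A a.
Proof.
apply: contrapT => H; apply: I0; apply/seteqP; split=> f.
  have id0 : is_ideal ([set 0]%classic : set {mpoly K[n]}).
    by split=> [//|x y /= -> ->|x y /= ->]; rewrite ?addr0 ?mulr0.
  by rewrite IE; apply: ideal_gen_sub => // g [a Aa _]; case: H; exists a.
move=> ->; rewrite IE.
by have [] := ideal_gen_ideal [set f | exists2 a, A a & f = 'X_[a] :> {mpoly K[n]}]%classic.
Qed.

Definition min_covers : pred {set 'I_n} := fun P => `[< min_primes I (wideal P 1) >].

Lemma prime_cover (p : set {mpoly K[n]}) : is_prime_ideal p -> (I `<=` p)%classic ->
  forall a, A a -> (0 < wdeg [set i | `[< p 'X_i >]]%SET a)%N.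
Proof.
move=> pp Ip a Aa; have [i ai pi] := prime_ideal_monomial pp (Ip _ (gen_mem Aa)).
by apply: leq_trans ai _; apply: wdeg_ge; rewrite inE; apply/asboolP.
Qed.

Lemma prime_wideal_sub (p : set {mpoly K[n]}) : is_prime_ideal p ->
  (wideal [set i | `[< p 'X_i >]]%SET 1 `<=` p)%classic.
Proof.
move=> /prime_idealP[pid _ _] f; apply: wideal_sub => // i.
by rewrite inE => /asboolP.
Qed.

(** The variables in a prime containing I generate a smaller prime that still contains I, since each
    monomial generator has a variable in the given prime. *)
Lemma min_primesE (p : set {mpoly K[n]}) : min_primes I p <->
  exists2 P, min_covers P & p = wideal P 1.
Proof.
split=> [mp|[P /asboolP mP ->] //]; have [pp Ip pmin] := mp.
pose P := [set i | `[< p 'X_i >]]%SET.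
have pE : wideal P 1 = p.
  apply: pmin; first exact: wideal_prime.
    by apply/cover_wideal; apply: prime_cover.
  exact: prime_wideal_sub.
by exists P => //; apply/asboolP; rewrite pE.
Qed.

Lemma min_covers_cover P a : min_covers P -> A a -> (0 < wdeg P a)%N.
Proof. by move=> /asboolP[_ /cover_wideal IP _] /IP. Qed.

Lemma min_covers_neq0 P : min_covers P -> exists i, i \in P.
Proof.
by move=> mP; have [a Aa] := gen_ex; have [i iP _] := wdeg_gt0 (min_covers_cover mP Aa); exists i.
Qed.

Lemma min_covers_ex : exists P, min_covers P.
Proof.
pose cov P := `[< forall a, A a -> (0 < wdeg P a)%N >].
have covT : cov [set: 'I_n]%SET.
  apply/asboolP => a /gen_neq0 a0; rewrite lt0n; apply: contra a0 => a0.
  rewrite -mdeg_eq0 mdegE; move: a0; rewrite /wdeg (eq_bigl xpredT) //.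
  by move=> i; rewrite inE.
(* A cover of least cardinality: the variables of a prime between I and [wideal P 1] form a cover
   inside [P], hence all of [P]. *)
have [P /asboolP Pcov Pmin] := arg_minnP (fun P : {set 'I_n} => #|P|) covT.
exists P; apply/asboolP; split; first exact: wideal_prime.
  exact/cover_wideal.
move=> q qp Iq qP; apply/seteqP; split=> // f.
have QP : [set i | `[< q 'X_i >]]%SET \subset P.
  apply/subsetP => i; rewrite inE => /asboolP/qP/widealX/wdeg_gt0[k kP].
  by rewrite mnm1E lt0b => /eqP ->.
have := Pmin [set i | `[< q 'X_i >]]%SET (asboolT (prime_cover qp Iq)) => le.
have -> : P = [set i | `[< q 'X_i >]]%SET.
  by apply/eqP; rewrite eq_sym eqEcard QP.
exact: prime_wideal_sub.
Qed.

(** By minimality some generator meets [P] only in [i]; being squarefree, it divides this monomial.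
    So I becomes the prime of [P] once the other variables are inverted. *)
Lemma min_covers_private P i : min_covers P -> i \in P ->
  I 'X_[U_(i) + mset (~: P)].
Proof.
move=> mP iP; have /asboolP[_ _ Pmin] := mP.
have [a Aa aP] : exists2 a, A a & wdeg (P :\ i) a = 0%N.
  apply: contrapT => H.
  have : wideal (P :\ i) 1 = wideal P 1 :> set {mpoly K[n]}.
    apply: Pmin; first exact: wideal_prime.
      apply/cover_wideal => a Aa; rewrite lt0n; apply/eqP => a0.
      by apply: H; exists a.
    move=> f fP u /fP; rewrite /wdeg (bigD1 i iP) /= => le.
    apply: leq_trans le _.
    rewrite [X in (_ <= _ + X)%N](eq_bigl (fun k => k \in P :\ i)) ?leq_addl //.
    by move=> k; rewrite !inE andbC.
  move=> /(congr1 (fun X : set {mpoly K[n]} => X 'X_i)) E.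
  have : wideal P 1 ('X_i : {mpoly K[n]}).
    by apply/widealX; apply: leq_trans (wdeg_ge _ iP); rewrite mnm1E eqxx.
  rewrite -E => /widealX/wdeg_gt0[k]; rewrite !inE mnm1E lt0b eq_sym => /andP[ki _].
  by rewrite (negbTE ki).
have le : (a <= U_(i) + mset (~: P))%MM.
  apply/mnm_lepP => k; rewrite mnmDE mnm1E !mnmE !inE.
  have [_|ki] := eqVneq i k; first by apply: leq_trans (Asqf Aa k) _.
  have [kP|kP] := boolP (k \in P); last by apply: leq_trans (Asqf Aa k) _.
  by apply: (@leq_trans 0) => //; rewrite -aP; apply: wdeg_ge; rewrite !inE eq_sym ki.
have [_ _ IM] := ideal_gen_ideal [set f | exists2 a, A a & f = 'X_[a] :> {mpoly K[n]}]%classic.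
by rewrite -(submK le) mpolyXD IE; apply: IM; rewrite -IE; apply: gen_mem.
Qed.

Lemma min_covers_pow P m u : min_covers P -> (m <= wdeg P u)%N ->
  ideal_pow I m 'X_[mset (~: P) *+ m + u].
Proof.
move=> mP; elim: m u => [|m IH] u mu; first exact: ideal_pow0.
have [i iP ui] := wdeg_gt0 (leq_trans (ltn0Sn m) mu).
have iu : (U_(i) <= u)%MM by rewrite lep1mP -lt0n.
have -> : (mset (~: P) *+ m.+1 + u =
    (U_(i) + mset (~: P)) + (mset (~: P) *+ m + (u - U_(i))))%MM.
  by rewrite -{1}(submK iu) mulmS; apply/mnmP => k; rewrite !mnmDE; lia.
rewrite mpolyXD; apply: ideal_powS; first exact: min_covers_private.
apply: IH; move: mu; rewrite -{1}(submK iu) wdegD.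
have -> : wdeg P U_(i) = 1%N; last by lia.
rewrite /wdeg (bigD1 i) //= mnm1E eqxx big1 // => k /andP[_ ki].
by rewrite mnm1E eq_sym (negbTE ki).
Qed.

Lemma loc_kernel_wideal P m : min_covers P ->
  loc_kernel (ideal_pow I m) (wideal P 1) = wideal P m.
Proof.
move=> mP; apply/seteqP; split=> f.
  case=> s s1 sf; apply: (wideal_primary s1).
  have : is_ideal (wideal P m : set {mpoly K[n]}) by exact: wideal_ideal.
  move/ideal_gen_sub; apply; last exact: sf.
  move=> _ [v vI ->]; elim: m v vI {sf} => [|m IH] v vI; first by [].
  rewrite big_ord_recl; apply: (@widealM _ _ P 1 m).
    by have /asboolP[_ IP _] := mP; apply: IP.
  by apply: IH.
(* A monomial in variables outside [P], so not in the prime; each of its m factors turns one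
   variable of [P] into an element of I. *)
move=> fm; exists 'X_[mset (~: P) *+ m].
  move=> /widealX/wdeg_gt0[i iP].
  by rewrite mulmnE !mnmE !inE iP.
have pid := ideal_gen_ideal
  [set f | exists2 u : 'I_m -> {mpoly K[n]}, forall i, I (u i) & f = \prod_(i < m) u i]%classic.
rewrite (mpolyE f) mulr_sumr big_seq_cond; apply: is_ideal_sum; first exact: pid.
move=> u; rewrite andbT mcoeff_msupp => /fm um.
have [_ _ pM] := pid.
by rewrite -scalerAr -mul_mpolyC -mpolyXD; apply: pM; apply: min_covers_pow.
Qed.

Lemma symbolic_power_wideal m :
  symbolic_power I m = [set f | forall P, min_covers P -> wideal P m f]%classic.
Proof.
apply/seteqP; split=> f H /=.
  move=> P mP; rewrite -(loc_kernel_wideal m mP); apply: H.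
  by apply/min_primesE; exists P.
by move=> p /min_primesE[P mP ->]; rewrite loc_kernel_wideal //; apply: H.
Qed.

End SquarefreeIdeals.

(** * Comparison of regularities *)

Section SymbolicRegularity.

Variables (K : fieldType) (n : nat) (PP : pred {set 'I_n}).
Hypotheses (PPex : exists P, PP P) (PPneq0 : forall P, PP P -> exists i, i \in P).
Implicit Types (m : nat) (a u : 'X_{1..n}).

Definition sym_exp m : pred 'X_{1..n} :=
  fun u => [forall (P : {set 'I_n} | PP P), (m <= wdeg P u)%N].

Lemma sym_exp_up m a b : (a <= b)%MM -> sym_exp m a -> sym_exp m b.
Proof.
move=> /mnm_lepP ab /forall_inP H; apply/forall_inP => P /H le.
by apply: leq_trans le _; apply: leq_sum.
Qed.

Let nv m a p := ~ kacyclic (ksys (ms_mod (ideal_stage K (sym_exp m))) a) p.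

(** The coordinate [a i] used on [t] stands for the exponent [a i - 1], and 0 there says that x_i
    cannot be divided out. *)
Lemma ksys_boxsys m a t (v : 'rV[K]_1) :
  ksys (ms_mod (ideal_stage K (sym_exp m))) a t v <->
  boxsys (sympred PP m) a (mnm_succ a) t v.
Proof.
rewrite /boxsys /suppsys /ksys /=.
have E : sympred PP m (mnm_mix t a (mnm_succ a)) =
    (mset t <= a)%MM && sym_exp m (a - mset t)%MM.
  rewrite /sympred; congr (_ && _).
    by apply/forallP/mnm_lepP => H i; have := H i; rewrite !mnmE; case: (i \in t).
  apply: eq_forallb_in => P _; congr (_ <= _)%N; apply: eq_bigr => i _.
  by rewrite !mnmE; case: (i \in t); rewrite ?subn1 ?subn0.
rewrite E; split=> [[->|[ta vM]]|[->|/andP[ta aJ]]]; try by left.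
  move: vM; rewrite ta /=; case: (sym_exp _ _); first by right.
  by rewrite raddf0 submx0 => /eqP; left.
by right; rewrite ta aJ submx1.
Qed.

Lemma nvE m a p : nv m a p <-> sym_nv 'rV[K]_1 PP m a p.
Proof.
split=> H H'; apply: H; apply: eq_kacyclic H' => t v; last by rewrite ksys_boxsys.
by rewrite -ksys_boxsys.
Qed.

(** Some [a j] exceeds [m], so even the lower exponent [a j - 1] satisfies every prime containing
    x_j: [j] is a cone point. *)
Lemma sym_exp_bound m a p : (n * m < mdeg a)%N ->
  kacyclic (ksys (ms_mod (ideal_stage K (sym_exp m))) a) p.
Proof.
move=> ma; have [j mj] : exists j, (m < a j)%N.
  apply/existsP; apply: contraTT ma; rewrite negb_exists => /forallP H.
  rewrite -leqNgt mdegE -[X in (_ <= X * _)%N]card_ord -sum_nat_const.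
  by apply: leq_sum => i _; rewrite leqNgt H.
apply: (@eq_kacyclic _ _ _ (suppsys (fun t => sympred PP m (mnm_mix t a (mnm_succ a))))).
  by move=> t v; rewrite ksys_boxsys.
apply: (kacyclic_cone (j := j)) => t /andP[/forallP t0 /forall_inP tP].
apply/andP; split.
  apply/forallP => i; rewrite mnmE in_setU1.
  have [->|_] := eqVneq i j; first by rewrite /=; lia.
  by have := t0 i; rewrite mnmE.
apply/forall_inP => P /[dup] PPP /tP le.
have [jP|jP] := boolP (j \in P).
  by rewrite (bigD1 j) //= mnmE setU11; lia.
rewrite (eq_bigr (fun i => (mnm_mix t a (mnm_succ a) i).-1)) // => i iP.
by rewrite !mnmE in_setU1; case: eqP iP jP => [->->|].
Qed.

(** An exponent of least degree in the ideal is a minimal generator, and its weight at any one prime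
    is already at least [m]. *)
Lemma nv_ex m : exists2 a, nv m a 0 & (m <= mdeg a)%N.
Proof.
have ex : exists d, `[< exists2 a, sym_exp m a & mdeg a = d >].
  exists (n * m)%N; apply/asboolP; exists [multinom m | i < n].
    apply/forall_inP => P /PPneq0[i iP].
    by apply: leq_trans (wdeg_ge _ iP); rewrite mnmE.
  rewrite mdegE -[X in (X * _)%N]card_ord -sum_nat_const.
  by apply: eq_bigr => i _; rewrite mnmE.
case: (ex_minnP ex) => d /asboolP[a Ja ad] dmin.
exists a; last first.
  have [P PPP] := PPex; have /forall_inP/(_ P PPP) le := Ja.
  apply: leq_trans le _; rewrite mdegE [X in (_ <= X)%N](bigID (mem P)) /=.
  exact: leq_addr.
rewrite /nv kacyclic0P /= Ja => H.
have : ((1%:M : 'M[K]_1) <= (0 : 'M_1))%MS.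
  apply: submx_trans H _; apply/sumsmx_subP => j aj.
  case Jj: (sym_exp m _); last by rewrite raddf0.
  have := mdeg_subU aj; have := dmin (mdeg (a - U_(j))%MM).
  by rewrite ad leqNgt => H lt; case/negP: (H (asboolT (ex_intro2 _ _ _ Jj erefl))).
by rewrite submx0 => /eqP/matrixP/(_ 0 0); rewrite !mxE eqxx => /eqP; rewrite oner_eq0.
Qed.

Lemma reg_transfer m m' d : (0 < m)%N ->
  (forall c p, (p < mdeg c)%N -> sym_nv 'rV[K]_1 PP m c p ->
     exists c' p', sym_nv 'rV[K]_1 PP m' c' p' /\ (mdeg c + p' + d <= mdeg c' + p)%N) ->
  reg (@mon_ideal K n (sym_exp m)) + d%:Z <= reg (@mon_ideal K n (sym_exp m')).
Proof.
move=> m0 H; have [a0 nv0 ma0] := nv_ex m.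
have [ge [a [p [nva regE]]]] :=
  @reg_mon_ideal _ _ (n * m).+1 _ (@sym_exp_up m) (@sym_exp_bound m) _ _ nv0.
(* The generator [a0] gives [reg >= m > 0], and [mdeg a - p] attains [reg]. *)
have pa : (p < mdeg a)%N by have := ge _ _ nv0; rewrite regE; lia.
have [c [q [/nvE nvc le]]] := H _ _ pa ((nvE _ _ _).1 nva).
have [ge' _] := @reg_mon_ideal _ _ (n * m').+1 _ (@sym_exp_up m') (@sym_exp_bound m') _ _ nvc.
by have := ge' _ _ nvc; rewrite regE; lia.
Qed.

End SymbolicRegularity.

Local Open Scope classical_set_scope.
Local Open Scope ring_scope.

Theorem corollary3p2 (K : fieldType) (n : nat) (I : set {mpoly K[n]})
    (Isqf : squarefree_monomial_ideal I)
    (Inonzero : I <> [set 0]) (Iproper : I <> [set: {mpoly K[n]}]) :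
  (forall k m : nat, (0 < k)%N -> (0 < m)%N ->
     reg (symbolic_power I (k * m)) >=
       reg (symbolic_power I m) + (k%:Z - 1) * m%:Z) /\
  reg (symbolic_power I 3) >= reg (symbolic_power I 2) + 1.
Proof.
have [A Asqf IE] := Isqf.
have PPex := min_covers_ex IE Iproper.
have PPneq0 P : min_covers I P -> exists i, i \in P.
  exact: (min_covers_neq0 IE Inonzero).
have symE m : symbolic_power I m = @mon_ideal K n (sym_exp (min_covers I) m).
  rewrite (symbolic_power_wideal Asqf IE); apply/seteqP; split=> f /= H.
    by move=> u uf; apply/forall_inP => P mP; apply: (H P mP).
  by move=> P mP u /H/forall_inP; apply.
split=> [k m k0 m0|]; rewrite !symE.
  have -> : (k%:Z - 1) * m%:Z = ((k - 1) * m)%N%:Z by rewrite PoszM -subzn.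
  by apply: reg_transfer => // c p; apply: sym_nv_mul.
by apply: reg_transfer => // c p; apply: sym_nv_23.
Qed.
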